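(* Let $d$ be a metric on $\langle\mathbb{F}_0\rangle$ such that $d$-balls in $\langle\mathbb{F}_0\rangle$ are convex sets. Suppose that: (1) for every $\epsilon>0$, $\Pi\left(f: K^\star(f_0,f)<\epsilon\right)>0$; (2) for every $\epsilon>0$, $\{f\in\langle\mathbb{F}_0\rangle:\inf_{0\le\alpha\le1}h^\star_\alpha(f_0,f)>e^{-\epsilon^2}\}\subseteq\{f\in\langle\mathbb{F}_0\rangle: d(f,f^\star)<\epsilon\}$. Let $\epsilon>0$ and, for $j\ge1$, let $N_j$ be the minimum number of $d$-balls in $\langle\mathbb{F}_0\rangle$ of radius $j\epsilon/3$ that cover the set $S_j=\{f\in\mathbb{F}_0: j\epsilon\le d(f,f^\star)<(j+1)\epsilon\}$. If $\sup_{j\ge1}N_j<\infty$, then $$\Pi\left(d(f,f^\star)>\epsilon\mid Y_{1:n}\right)\to0\quad\text{as }n\to\infty,\qquad\mathsf{P}_0\text{-almost surely}.$$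
   Context: Let $(\mathbb{Y},\mathscr{Y},\mu)$ be a $\sigma$-finite measure space, $\mathbb{F}_0$ a family of probability densities with respect to $\mu$, and $f_0$ a ''true'' probability density with respect to $\mu$, not necessarily in $\mathbb{F}_0$. $Y_1,Y_2,\dots$ are i.i.d. with density $f_0$, $Y_{1:n}=(Y_1,\dots,Y_n)$; $\mathsf{P}_0,\mathsf{E}_0$ denote probability and expectation under $f_0$ (and under its products). $\Pi$ is a probability measure (prior) on $\mathbb{F}_0$; it is understood that families of densities carry a $\sigma$-algebra making $(y,f)\mapsto f(y)$ jointly measurable and $d$-balls measurable. $K(f_0,f)=\mathsf{E}_0\log(f_0/f)=\int\log(f_0/f)\,f_0\,d\mu$. There is a fixed unique $f^\star\in\mathbb{F}_0$ with $K(f_0,f^\star)=\inf_{f\in\mathbb{F}_0}K(f_0,f)$, understood to be finite, and for any density $f$, $K^\star(f_0,f)=K(f_0,f)-K(f_0,f^\star)$. Standing assumptions: $\int(f/f^\star)f_0\,d\mu<\infty$ for all $f\in\mathbb{F}_0$, and $\int(f_0/f^\star)\,d\mu<\infty$. A set $A$ of densities is called convex if it is closed under mixtures: for every probability measure $\nu$ on $A$, the density $\int_A f\,\nu(df)$ belongs to $A$. $\langle\mathbb{F}_0\rangle$ is the smallest convex set (in this sense) containing $\mathbb{F}_0$, and $\Pi$ is extended to $\langle\mathbb{F}_0\rangle$ by $\Pi(A)=\Pi(A\cap\mathbb{F}_0)$. $h^\star_\alpha(f_0,f)=\mathsf{E}_0(f/f^\star)^\alpha=\int(f/f^\star)^\alpha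 f_0\,d\mu$ for $0<\alpha\le1$, and $h^\star_0(f_0,f)=1$. The posterior is $$\Pi(A\mid Y_{1:n})=\frac{\int_A\prod_{i=1}^n \frac{f(Y_i)}{f^\star(Y_i)}\,d\Pi(f)}{\int\prod_{i=1}^n \frac{f(Y_i)}{f^\star(Y_i)}\,d\Pi(f)}.$$ *)

(* Defs.v *)
(* Densities are identified when they agree mu-almost everywhere.  A family of
   densities is a measurable type T, whose sigma-algebra is the one carried by
   the family, with a map p : T -> Y -> R choosing a version of each density
   such that (f, y) |-> p f y is jointly measurable.  (The set of all versions
   of all densities does not in general carry a sigma-algebra making evaluation
   jointly measurable, hence the choice of one version per class.) *)
From HB Require Import structures.
From mathcomp Require Import all_boot all_order all_algebra.
From mathcomp Require Import all_classical all_reals all_analysis.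

Set Implicit Arguments.
Unset Strict Implicit.
Unset Printing Implicit Defensive.

Import Order.TTheory GRing.Theory Num.Theory.
Import numFieldNormedType.Exports.

Local Open Scope classical_set_scope.
Local Open Scope ring_scope.
Local Open Scope ereal_scope.

Section densities.
Context {d : measure_display} {Y : measurableType d} {R : realType}.
Variable mu : {measure set Y -> \bar R}.

Definition is_density (f : Y -> R) : Prop :=
  [/\ measurable_fun setT f, (forall y, (0 <= f y)%R) &
      \int[mu]_y (f y)%:E = 1].

(* In \bar R, 0^-1 = +oo and 0 * +oo = 0: the ratio is +oo where
   g = 0 < f, and 0 where f = g = 0. *)
Definition density_ratio (f g : Y -> R) (y : Y) : \bar R := (f y)%:E / (g y)%:E.

(* Since lne 0 = -oo, lne +oo = +oo and +-oo * 0 = 0, the integrand is 0 where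
   f0 = 0 and +oo where f = 0 < f0. *)
Definition KL (f0 f : Y -> R) : \bar R :=
  \int[mu]_y (lne (density_ratio f0 f y) * (f0 y)%:E).

Definition KLstar (f0 fstar f : Y -> R) : \bar R := KL f0 f - KL f0 fstar.

Definition hstar (f0 fstar f : Y -> R) (alpha : R) : \bar R :=
  if alpha == 0%R then 1
  else \int[mu]_y (poweR (density_ratio f fstar y) alpha * (f0 y)%:E).

Definition inf_hstar (f0 fstar f : Y -> R) : \bar R :=
  ereal_inf [set hstar f0 fstar f alpha | alpha in `[0%R, 1%R]%classic].

End densities.

Section families.
Context {dY dT : measure_display} {Y : measurableType dY}
  {T : measurableType dT} {R : realType}.
Variables (mu : {measure set Y -> \bar R}) (p : T -> Y -> R).

Record density_family : Prop := DensityFamily {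
  family_density : forall t, is_density mu (p t) ;
  family_measurable : measurable_fun [set: T * Y] (fun z => p z.1 z.2) ;
  family_inj : forall s t, {ae mu, forall y, p s y = p t y} -> s = t }.

(* nu has outer measure 1 on A: such nu are exactly the images in T of the
   probability measures on A for the trace sigma-algebra; when A is measurable
   this says nu A = 1. *)
Definition carried_by (nu : probability T R) (A : set T) : Prop :=
  forall B, measurable B -> A `<=` B -> nu B = 1.

Definition mixture (nu : probability T R) (y : Y) : \bar R :=
  \int[nu]_t (p t y)%:E.

Definition mixture_convex (A : set T) : Prop :=
  forall nu : probability T R, carried_by nu A ->
    exists2 t, A t & {ae mu, forall y, (p t y)%:E = mixture nu y}.

(* The whole family T is the smallest convex set containing F0.  The first
   clause is not implied by the second: without it, T could lack mixtures. *)
Definition is_convex_hull (F0 : set T) : Prop :=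
  mixture_convex [set: T] /\ smallest mixture_convex F0 = [set: T].

End families.

Section metrics.
Context {T : Type} {R : realType}.
Variable d : T -> T -> R.

Record is_metric : Prop := IsMetric {
  metric_ge0 : forall s t, (0 <= d s t)%R ;
  metric_eq0 : forall s t, d s t = 0%R <-> s = t ;
  metric_sym : forall s t, d s t = d t s ;
  metric_triangle : forall s t u, (d s u <= d s t + d t u)%R }.

Definition dball (c : T) (r : R) : set T := [set t | (d t c < r)%R].

(* +oo when no finite family of balls covers S. *)
Definition covering_number (r : R) (S : set T) : \bar R :=
  ereal_inf [set (n%:R)%:E | n in
    [set n : nat | exists c : 'I_n -> T, S `<=` \bigcup_i dball (c i) r]].

End metrics.

Section sampling.
Context {dO dY dT : measure_display} {Omega : measurableType dO}
  {Y : measurableType dY} {T : measurableType dT} {R : realType}.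
Variable P : probability Omega R.

Definition mutually_independent (X : nat -> {RV P >-> Y}) : Prop :=
  forall (s : seq nat) (B : nat -> set Y), uniq s ->
    (forall i, measurable (B i)) ->
    P (\big[setI/setT]_(i <- s) (X i @^-1` B i)) =
    \prod_(i <- s) P (X i @^-1` B i).

Definition iid_density (mu : {measure set Y -> \bar R}) (f0 : Y -> R)
    (X : nat -> {RV P >-> Y}) : Prop :=
  mutually_independent X /\
  forall i B, measurable B -> distribution P (X i) B = \int[mu]_(y in B) (f0 y)%:E.

(* X 0, ..., X (n - 1) are the observations Y_1, ..., Y_n. *)
Definition posterior (p : T -> Y -> R) (Pi : probability T R) (fstar : Y -> R)
    (X : nat -> {RV P >-> Y}) (n : nat) (w : Omega) (A : set T) : \bar R :=
  (\int[Pi]_(t in A) \prod_(i < n) density_ratio (p t) fstar (X i w)) /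
  (\int[Pi]_t \prod_(i < n) density_ratio (p t) fstar (X i w)).

End sampling.

(* Main.v *)
(* Let q_t = p_t / p_tstar.  For a convex set A of densities, the restricted
   likelihood L_n(A) = int_A prod_(i < n) q_t(Y_i) dPi(t) satisfies
   L_(n+1)(A) = L_n(A) q_t(Y_(n+1)), where p_t is the predictive density, a
   mixture over A and hence a member of A.  So if E_0 q_t^alpha <= c for all t
   in A, with the same alpha in [0, 1], then E_0 L_n(A)^alpha <= c^n.
   Hypothesis (2) only gives an alpha depending on t; since t |-> E_0 q_t^alpha
   is concave and alpha |-> E_0 q_t^alpha is convex, a minimax argument makes
   alpha uniform over A, at the price of an arbitrarily small increase of c.
   The annulus S_j is covered by boundedly many balls at distance at least
   j eps / 3 from tstar, whose expectations are at most exp(- n j eps^2 / 10);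
   summing over n and j, the numerator of the posterior is O(r^n) almost surely,
   with r = exp(- eps^2 / 20).

   For the denominator, hypothesis (1) and the strong law of large numbers give
   prod_(i < n) q_t(Y_i) >= m_t exp(- n e) for all n, with m_t > 0, for t in a
   set of positive prior mass.  Only half of the strong law is needed, that a
   random walk with negative drift is bounded above, and this follows from the
   maximal ergodic lemma. *)
Require Import Defs.
From HB Require Import structures.
From mathcomp Require Import all_boot all_order all_algebra.
From mathcomp Require Import all_classical all_reals all_analysis.
From mathcomp Require Import measurable_realfun ring lra.

Set Implicit Arguments.
Unset Strict Implicit.
Unset Printing Implicit Defensive.

Import Order.TTheory GRing.Theory Num.Theory.
Import numFieldNormedType.Exports.

Local Open Scope classical_set_scope.
Local Open Scope ring_scope.
Local Open Scope ereal_scope.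

(** * Powers and minimax *)

(** The moment bound and the maximal ergodic lemma rest on the same identity: prepending an
    independent observation to a sequence preserves the law [Lam] of the sequence of observations.
    The observations are therefore moved from [Omega] to [seqspace], and no conditional expectation
    occurs.

    The exponent given by the minimax argument depends on the ball and may be arbitrarily close to
    0, or 0 itself. A bound on [L^alpha] can then not be turned into a bound on [L] by a power
    [1 / alpha]; instead the likelihood is rescaled before the power is taken.

    The constants: condition (2) at radius [j eps / 3] gives exp(- j^2 eps^2 / 9), at most exp(- j
    eps^2 / 9); passing from 9 to 10 makes room for the strict inequality that the minimax argument
    asks for. Half of the exponent j eps^2 / 10 is spent on the rescaling. What is left, at j = 1,
    is the rate eps^2 / 20 of the numerator, and the denominator is allowed to lose half of it. *)

Section real_power.
Context {R : realType}.
Local Open Scope ring_scope.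
Implicit Types x y a b t : R.

(* Unlike powR, rpow has 0^0 = 0: this makes rpow x continuous on [0, 1], hence
   the moments lower semicontinuous, as the minimax argument requires.  The
   case a = 0 then bounds the probability that the likelihood is nonzero. *)
Definition rpow x a : R := if x == 0 then 0 else expR (a * ln x).

Lemma rpow0 a : rpow 0 a = 0.
Proof. by rewrite /rpow eqxx. Qed.

Lemma rpow_ge0 x a : 0 <= rpow x a.
Proof. by rewrite /rpow; case: ifP => // _; exact: expR_ge0. Qed.

Lemma rpowE x a : a != 0 -> rpow x a = x `^ a.
Proof. by move=> a0; rewrite /rpow /powR; case: eqP => // _; rewrite (negbTE a0).
Qed.

Lemma rpowM x y a : 0 <= x -> 0 <= y -> rpow (x * y) a = rpow x a * rpow y a.
Proof.
rewrite /rpow mulf_eq0 !le0r.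
have [->|x0] /= := eqVneq x 0; first by rewrite mul0r.
have [->|y0] /= := eqVneq y 0; first by rewrite mulr0.
by move=> xp yp; rewrite lnM// mulrDr expRD.
Qed.

Lemma rpow_lt1 x a : 0 <= a -> rpow x a < 1 -> x <= 1.
Proof.
move=> a0; rewrite /rpow; case: eqP => [->//|_] h; rewrite leNgt; apply/negP => x1.
by move: h; rewrite -expR0 ltr_expR ltNge mulr_ge0// ln_ge0// ltW.
Qed.

(** The tangent to exp at [z] lies below exp, and in the weighted mean of its values at [x] and [y]
    the slope terms cancel. *)
Lemma expR_conv t x y : 0 <= t <= 1 ->
  expR (t * x + (1 - t) * y) <= t * expR x + (1 - t) * expR y.
Proof.
move=> /andP[t0 t1].
set z := t * x + _.
have tan w : expR z * (1 + (w - z)) <= expR w.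
  have -> : expR w = expR z * expR (w - z) by rewrite -expRD addrC subrK.
  by rewrite ler_pM2l ?expR_gt0// expR_ge1Dx.
have : t * (expR z * (1 + (x - z))) + (1 - t) * (expR z * (1 + (y - z))) <=
    t * expR x + (1 - t) * expR y.
  by apply: lerD; apply: ler_wpM2l => //; rewrite subr_ge0.
apply: le_trans; rewrite le_eqVlt; apply/orP; left; apply/eqP.
rewrite /z; ring.
Qed.

Lemma rpow_conv x a b t : 0 <= t <= 1 ->
  rpow x (t * a + (1 - t) * b) <= t * rpow x a + (1 - t) * rpow x b.
Proof.
rewrite /rpow; case: ifP => _ t01; first by rewrite !mulr0 addr0.
by rewrite mulrDl -!mulrA expR_conv.
Qed.

(** Bernoulli's inequality, read off from the convexity of exp between [ln x], with weight [a], and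
    0. *)
Lemma rpow_tangent x a : 0 <= x -> 0 <= a <= 1 -> rpow x a <= 1 + a * (x - 1).
Proof.
move=> x0 /[dup] a01 /andP[a0 a1]; rewrite /rpow; case: eqP => [->|/eqP xn0].
  by rewrite sub0r mulrN1 subr_ge0.
have xp : 0 < x by rewrite lt0r xn0.
have := expR_conv (ln x) 0 a01; rewrite mulr0 addr0 expR0 lnK ?posrE// => h.
by apply: le_trans h _; rewrite le_eqVlt; apply/orP; left; apply/eqP; ring.
Qed.

(** By homogeneity, Bernoulli's inequality at [w / m] is a tangent bound at the mean [m]; averaging
    it over [x] and [y] cancels the slope terms. The case [a = 0] is included: [rpow _ 0] is the
    indicator of nonzero reals. *)
Lemma rpow_concave x y a t : 0 <= x -> 0 <= y -> 0 <= a <= 1 -> 0 <= t <= 1 ->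
  t * rpow x a + (1 - t) * rpow y a <= rpow (t * x + (1 - t) * y) a.
Proof.
move=> x0 y0 a01 /andP[t0 t1].
have t1' : 0 <= 1 - t by rewrite subr_ge0.
set m := t * x + _.
have [m0|mn0] := eqVneq m 0.
  have : t * x = 0 /\ (1 - t) * y = 0.
    have A : 0 <= t * x by rewrite mulr_ge0.
    have B : 0 <= (1 - t) * y by rewrite mulr_ge0.
    by move: m0; rewrite /m; split; lra.
  case=> /eqP + /eqP; rewrite !mulf_eq0 => /orP[]/eqP-> /orP[]/eqP->;
    by rewrite ?rpow0 ?mul0r ?mulr0 ?addr0 ?rpow_ge0.
have mp : 0 < m by rewrite lt0r mn0 addr_ge0// mulr_ge0.
have tan w : 0 <= w -> rpow w a <= rpow m a * (1 + a * (w / m - 1)).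
  move=> w0; rewrite -[in X in X <= _](divfK mn0 w) mulrC rpowM//; last 2 first.
    exact: ltW.
    by rewrite divr_ge0// ltW.
  by rewrite ler_wpM2l ?rpow_ge0// rpow_tangent// divr_ge0// ltW.
have : t * rpow x a + (1 - t) * rpow y a <= t * (rpow m a * (1 + a * (x / m - 1)))
   + (1 - t) * (rpow m a * (1 + a * (y / m - 1))).
  by apply: lerD; apply: ler_wpM2l => //; exact: tan.
move/le_trans; apply; rewrite le_eqVlt; apply/orP; left; apply/eqP.
have -> : t * (rpow m a * (1 + a * (x / m - 1)))
   + (1 - t) * (rpow m a * (1 + a * (y / m - 1))) =
   rpow m a * (1 + a * ((t * x + (1 - t) * y) / m - 1)) by ring.
by rewrite -/m divff// subrr mulr0 addr0 mulr1.
Qed.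

(** According to the sign of [ln x], one of the two terms on the right dominates. This is what
    passes finiteness of a moment down to smaller exponents. *)
Lemma rpow_le1D x a b : 0 <= a -> a <= b -> rpow x a <= 1 + rpow x b.
Proof.
move=> a0 ab; rewrite /rpow; case: ifP => _; first by rewrite addr0.
have [x0|x0] := leP 0 (ln x).
  by rewrite -[X in X <= _]add0r lerD// ler_expR ler_wpM2r.
have : expR (a * ln x) <= 1 by rewrite -expR0 ler_expR mulr_ge0_le0// ltW.
by move=> h; rewrite -[X in X <= _]addr0 lerD// expR_ge0.
Qed.

Lemma cvg_rpow x (u : R^nat) a : u @ \oo --> a -> rpow x (u n) @[n --> \oo] --> rpow x a.
Proof.
move=> ua; rewrite /rpow; case: ifP => _; first exact: cvg_cst.
apply: continuous_cvg; first exact: continuous_expR.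
by apply: cvgM => //; exact: cvg_cst.
Qed.

Lemma measurable_rpow a : measurable_fun setT (fun x => rpow x a).
Proof.
rewrite /rpow; apply: measurable_fun_if => //.
- exact: measurable_fun_eqr.
- apply: measurableT_comp => //; apply: measurable_funM => //.
  by apply: measurable_funTS; exact: measurable_ln.
Qed.

End real_power.

Section minimax.
Context {R : realType}.
Local Open Scope ereal_scope.

Definition unitI : set R := [set a | (0 <= a <= 1)%R].

Definition cvx01 (u : R -> \bar R) := forall a b t, unitI a -> unitI b -> unitI t ->
  u (t * a + (1 - t) * b)%R <= t%:E * u a + (1 - t)%R%:E * u b.

(** Moments may be infinite, but only to the right of the exponents where they are finite. *)
Definition finite_below (u : R -> \bar R) := forall a b, (0 <= a)%R -> (a <= b)%R -> (b <= 1)%R ->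
  u b < +oo -> u a < +oo.

Lemma segment_param (a b x : R) : (a <= x <= b)%R -> exists2 t, unitI t & x = (t * a + (1 - t) * b)%R.
Proof.
move=> /andP[ax xb]; have [ab|ab] := eqVneq a b.
  exists 0%R; first by rewrite /unitI /= lexx ler01.
  by rewrite mul0r subr0 mul1r add0r; apply/eqP; rewrite eq_le xb -ab ax.
have d0 : (0 < b - a)%R by rewrite subr_gt0 lt_neqAle ab (le_trans ax xb).
exists ((b - x) / (b - a))%R.
  by rewrite /unitI /= divr_ge0 ?subr_ge0 ?(ltW d0) ?(le_trans ax xb)//= ler_pdivrMr// mul1r lerB.
by field; rewrite subr_eq0 eq_sym.
Qed.

(** Quasi-convexity: sublevel sets are intervals. *)
Lemma cvx01_le (u : R -> \bar R) a b x (c : R) :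
  (forall a, 0 <= u a) -> cvx01 u -> unitI a -> unitI b ->
  (a <= x <= b)%R -> u a <= c%:E -> u b <= c%:E -> u x <= c%:E.
Proof.
move=> u0 cu a1 b1 /segment_param[t t1 ->] ua ub;
  apply: (le_trans (cu _ _ _ a1 b1 t1)).
have /andP[t0 t1'] := t1.
have -> : c%:E = t%:E * c%:E + (1 - t)%R%:E * c%:E by rewrite -!EFinM -EFinD;
  congr EFin; ring.
by apply: leeD; apply: lee_wpmul2l => //; rewrite lee_fin// subr_ge0.
Qed.


(* Otherwise some point between a and b would bring the linear interpolations of
   both u and v below c. *)
Lemma exchange_disjoint (u v : R -> \bar R) (c : R) a b :
  (forall x, 0 <= u x) -> (forall x, 0 <= v x) -> cvx01 u -> cvx01 v -> unitI a -> unitI b ->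
  (forall x, unitI x -> ~ (u x <= c%:E /\ v x <= c%:E)) ->
  forall ua ub va vb : R, u a = ua%:E -> u b = ub%:E -> v a = va%:E -> v b = vb%:E ->
  (ua <= c -> c < va -> vb <= c -> c < ub ->
   (c - ua) * (c - vb) < (ub - c) * (va - c))%R.
Proof.
move=> u0 v0 cu cv a1 b1 dis ua ub va vb Ea Eb Fa Fb A C D B.
rewrite ltNge; apply/negP => h.
have AB : (0 < (c - ua) + (ub - c))%R by lra.
(* With this weight the interpolation of [u] equals [c] exactly; [h] says that the interpolation of
   [v] is then at most [c]. *)
pose t := ((ub - c) / ((c - ua) + (ub - c)))%R.
have t1 : unitI t.
  rewrite /unitI /= /t divr_ge0 ?(ltW AB) ?subr_ge0 ?(ltW B)//= ler_pdivrMr// mul1r; lra.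
have /andP[t0 t1'] := t1.
apply: (dis (t * a + (1 - t) * b)%R).
  rewrite /unitI/=; case/andP : a1 => a0 a1; case/andP : b1 => b0 b1'; apply/andP;
    split.
    by apply: addr_ge0; apply: mulr_ge0 => //; rewrite subr_ge0.
  have : (t * a <= t * 1)%R by rewrite ler_wpM2l.
  have : ((1 - t) * b <= (1 - t) * 1)%R by rewrite ler_wpM2l// subr_ge0.
  lra.
have tE : (t * ((c - ua) + (ub - c)) = ub - c)%R by rewrite /t divfK// gt_eqF.
split.
  apply: (le_trans (cu _ _ _ a1 b1 t1)); rewrite Ea Eb -!EFinM -EFinD lee_fin.
  rewrite (_ : _ + _ = c + ((ub - c) - t * ((c - ua) + (ub - c))))%R; last by ring.
  by rewrite tE subrr addr0.
apply: (le_trans (cv _ _ _ a1 b1 t1)); rewrite Fa Fb -!EFinM -EFinD lee_fin.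
rewrite -subr_ge0 -(pmulr_lge0 _ AB).
rewrite (_ : _ * _ = ((c - vb) * ((c - ua) + (ub - c)) - (t * ((c - ua) + (ub - c))) * ((va - c) + (c - vb))))%R; last by ring.
rewrite tE.
rewrite (_ : _ - _ = (c - ua) * (c - vb) - (ub - c) * (va - c))%R; last by ring.
by rewrite subr_ge0.
Qed.

(** Lower semicontinuity as sequential closedness of the sublevel sets at real levels, the form that
    Fatou's lemma delivers. *)
Definition seq_lsc (u : R -> \bar R) := forall (x : R^nat) a (c : R), (forall n, unitI (x n)) ->
  x @ \oo --> a -> (forall n, u (x n) <= c%:E) -> u a <= c%:E.

Lemma unitI_cvg (x : R^nat) (a : R) : (forall n, unitI (x n)) -> x @ \oo --> a -> unitI a.
Proof.
move=> x1 xa; apply/andP; split.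
  by rewrite -(cvg_lim _ xa)//; apply: limr_ge; [apply/cvg_ex; exists a|near=> n;
    case/andP: (x1 n)].
by rewrite -(cvg_lim _ xa)//; apply: limr_le; [apply/cvg_ex; exists a|near=> n;
  case/andP: (x1 n)].
Unshelve. all: by end_near.
Qed.

Lemma adherent_cvg (x : R^nat) (a : R) : (forall n, `|x n - a| < n.+1%:R^-1)%R -> x @ \oo --> a.
Proof.
move=> h; apply/subr_cvg0/norm_cvg0P.
apply: (@squeeze_cvgr _ _ _ _ (fun=> 0%R) (fun n => n.+1%:R^-1)%R).
- by near=> n; rewrite normr_ge0/= ltW.
- exact: cvg_cst.
- exact: cvg_harmonic.
Unshelve. all: by end_near.
Qed.

Lemma sublevel_sup (u : R -> \bar R) (c : R) : seq_lsc u ->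
  [set a | unitI a /\ u a <= c%:E] !=set0 ->
  let s := sup [set a | unitI a /\ u a <= c%:E] in
  [/\ unitI s, u s <= c%:E & forall a, unitI a -> u a <= c%:E -> (a <= s)%R].
Proof.
set K := [set a | _] => lu K0 s.
have hsK : has_sup K by split => //; exists 1%R => a [/andP[]].
have ex n : {x | K x & `|x - s| < n.+1%:R^-1}%R.
  apply: cid2; have n0 : (0 < n.+1%:R^-1 :> R)%R by [].
  have [x Kx sx] := sup_adherent n0 hsK; exists x => //.
  have xs : (x <= s)%R by apply: ub_le_sup => //; case: hsK.
  by rewrite ler0_norm ?subr_le0//; rewrite opprB ltrBlDr addrC -ltrBlDr.
pose x n := s2val (ex n).
have xK n : K (x n) := s2valP (ex n).
have xs : x @ \oo --> s by apply: adherent_cvg => n; exact: (s2valP' (ex n)).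
split.
- by apply: unitI_cvg xs => n; case: (xK n).
- by apply: lu xs _ => n; case: (xK n).
- by move=> a a1 ua; apply: ub_le_sup => //; case: hsK.
Qed.

(* The weight t satisfies t / (1 - t) = inf (v - c) / (c - u) over {u < c}.  The
   infimum is positive, while the supremum of (c - v) / (u - c) over {v < c}
   would also do except that it vanishes if u = +oo there. *)
Lemma two_functions_minimax (u v : R -> \bar R) (c : R) :
  (forall x, 0 <= u x) -> (forall x, 0 <= v x) -> cvx01 u -> cvx01 v ->
  finite_below v -> seq_lsc u ->
  (forall x, unitI x -> ~ (u x <= c%:E /\ v x <= c%:E)) ->
  forall ai aj, unitI ai -> unitI aj -> u ai < c%:E -> v aj < c%:E -> (ai < aj)%R ->
  exists2 t, unitI t & forall x, unitI x -> c%:E <= t%:E * u x + (1 - t)%:E * v x.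
Proof.
move=> u0 v0 cu cv fv lu dis ai aj ai1 aj1 uai vaj aij.
have fin (w : R -> \bar R) x : (forall x, 0 <= w x) -> w x < +oo -> {r | w x = r%:E /\ (0 <= r)%R}.
  by move=> w0 wx; exists (fine (w x)); rewrite fineK ?ge0_fin_numE// fine_ge0.
have c0 : (0 < c)%R by rewrite -lte_fin (le_lt_trans _ uai).
have K0 : [set a | unitI a /\ u a <= c%:E] !=set0 by exists ai; split => //;
  exact: ltW.
have [b1 ub Kb] := sublevel_sup lu K0; set b := sup _ in b1 ub Kb.
have vgt x : unitI x -> u x <= c%:E -> c%:E < v x.
  by move=> x1 ux; rewrite ltNge; apply/negP => vx; exact: (dis x).
(* Otherwise [aj] would lie in the interval from [ai] to [b], on which [u <= c]. *)
have baj : (b < aj)%R.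
  rewrite ltNge; apply/negP => ajb; apply: (dis aj) => //; split; last exact: ltW.
  by apply: (@cvx01_le u ai b) => //; [rewrite (ltW aij)|exact: ltW].
have [va [vaE va0]] := fin v aj v0 (lt_trans vaj (ltry _)).
have vac : (va < c)%R by rewrite -lte_fin -vaE.
have vfin x : unitI x -> (x <= b)%R -> {r | v x = r%:E /\ (0 <= r)%R}.
  move=> /andP[x0 x1] xb; apply: fin => //; apply: (fv x aj) => //.
  - by rewrite (le_trans xb)// ltW.
  - by case/andP : aj1.
  - by rewrite vaE ltry.
have [vb [vbE vb0]] := vfin b b1 (lexx _).
have vbc : (c < vb)%R by rewrite -lte_fin -vbE; exact: vgt.
(* As [v] exceeds [c] at [b] and is below [c] at [aj], to the right of [b], convexity forbids it to
   be smaller to the left of [b] than at [b]. *)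
have vlow x r : unitI x -> (x <= b)%R -> v x = r%:E -> (vb <= r)%R.
  move=> x1 xb vxE; rewrite leNgt; apply/negP => rvb.
  have : v b <= (Num.max r va)%:E.
    apply: (@cvx01_le v x aj) => //.
    - by rewrite xb ltW.
    - by rewrite vxE lee_fin le_max lexx.
    - by rewrite vaE lee_fin le_max lexx orbT.
  by rewrite vbE lee_fin le_max leNgt rvb/= leNgt (lt_trans vac).
pose E : set R := [set r | exists x ux vx, [/\ unitI x, u x = ux%:E, v x = vx%:E, (ux < c)%R &
  r = (vx - c) / (c - ux)]%R].
(* Numerators are at least [vb - c] by [vlow], denominators at most [c] because [u >= 0]. The
   resulting positivity of [rho] gives [u] a positive weight, which settles the points where [u] is
   infinite. *)
have Elow : lbound E ((vb - c) / c)%R.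
  move=> _ [x [ux [vx [x1 uxE vxE uxc ->]]]].
  have ux0 : (0 <= ux)%R by rewrite -lee_fin -uxE.
  have vbx : (vb <= vx)%R by apply: (@vlow x) => //; apply: Kb => //;
    rewrite uxE lee_fin ltW.
  rewrite ler_pM ?invr_ge0 ?(ltW c0) ?subr_ge0 ?(ltW vbc)//; first by rewrite lerB.
  by rewrite lef_pV2 ?posrE ?subr_gt0// lerBlDr lerDl.
have E0 : E !=set0.
  have [ua [uaE _]] := fin u ai u0 (lt_trans uai (ltry _)).
  have [va' [va'E _]] := vfin ai ai1 (Kb _ ai1 (ltW uai)).
  by exists ((va' - c) / (c - ua))%R, ai, ua, va'; split => //;
    rewrite -lte_fin -uaE.
pose rho := inf E.
have rho0 : (0 < rho)%R.
  by apply: (@lt_le_trans _ _ ((vb - c) / c)%R);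
    [rewrite divr_gt0// subr_gt0|exact: lb_le_inf].
have rho1 : (0 < 1 + rho)%R by rewrite addr_gt0.
exists (rho / (1 + rho))%R.
  by rewrite /unitI/= divr_ge0 ?(ltW rho0) ?(ltW rho1)//= ler_pdivrMr// mul1r lerDr.
move=> x x1; rewrite leNgt; apply/negP.
have -> : (1 - rho / (1 + rho) = (1 + rho)^-1)%R by field; rewrite gt_eqF.
have [ux|/(fin u _ u0)[ux [uxE ux0]]] := leP +oo (u x).
  have -> : u x = +oo by apply/eqP; rewrite -leye_eq.
  by rewrite gt0_muley ?lte_fin ?divr_gt0// addye ?gt_eqF// (lt_le_trans _ (mule_ge0 _ _))// lee_fin invr_ge0 ltW.
have [vx|/(fin v _ v0)[vx [vxE vx0]]] := leP +oo (v x).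
  have -> : v x = +oo by apply/eqP; rewrite -leye_eq.
  by rewrite [X in _ + X]gt0_muley ?lte_fin ?invr_gt0// uxE -EFinM addey.
rewrite uxE vxE -!EFinM -EFinD lte_fin.
rewrite (_ : _ + _ = c + (rho * (ux - c) + (vx - c)) / (1 + rho))%R; last by field;
  rewrite gt_eqF.
rewrite -ltrBrDl subrr pmulr_llt0 ?invr_gt0// => neg.
(* Left of [c], [rho] is at most the quotient at [x] itself. Right of [c], [exchange_disjoint]
   bounds every quotient in [E], hence [rho], from below by [(c - vx) / (ux - c)]. At [c],
   disjointness gives [vx > c]. *)
have [uc|cu'|uc] := ltgtP ux c.
- have : (rho <= (vx - c) / (c - ux))%R.
    by apply: ge_inf; [exists ((vb - c) / c)%R|exists x, ux, vx].
  rewrite ler_pdivlMr ?subr_gt0// => h.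
  by move: neg; rewrite ltNge; apply/negP; rewrite negbK; move: h; lra.
- have vc : (vx < c)%R.
    have : (0 < rho * (ux - c))%R by rewrite mulr_gt0// subr_gt0.
    by move: neg; lra.
  have : ((c - vx) / (ux - c) <= rho)%R.
    apply: lb_le_inf => // _ [y [uy [vy [y1 uyE vyE uyc ->]]]].
    have vyc : (c < vy)%R by rewrite -lte_fin -vyE; apply: vgt => //;
      rewrite uyE lee_fin ltW.
    have := exchange_disjoint u0 v0 cu cv y1 x1 dis uyE uxE vyE vxE (ltW uyc) vyc (ltW vc) cu'.
    move=> h; rewrite ler_pdivrMr ?subr_gt0// mulrAC ler_pdivlMr ?subr_gt0//.
    by move: h; lra.
  by rewrite ler_pdivrMr ?subr_gt0//; move: neg; lra.
- have := vgt x x1; rewrite uxE uc lexx vxE lte_fin => /(_ isT) cv'.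
  by move: neg; rewrite uc subrr mulr0 add0r; move: cv'; lra.
Qed.

(* By Helly's theorem on the line it suffices that the sublevel intervals at c
   meet pairwise. *)
Theorem minimax01 (I : Type) (H : I -> R -> \bar R) (c : R) :
  (forall i a, 0 <= H i a) -> (forall i, cvx01 (H i)) ->
  (forall i, finite_below (H i)) -> (forall i, seq_lsc (H i)) ->
  (forall i j t, unitI t -> exists k, forall a, unitI a ->
     t%:E * H i a + (1 - t)%:E * H j a <= H k a) ->
  (forall i, exists2 a, unitI a & H i a < c%:E) ->
  exists2 a, unitI a & forall i, H i a <= c%:E.
Proof.
move=> H0 Hc Hf Hl Hk Hlt.
(* If the two sublevel sets were disjoint, some weighted mean of [H i] and [H j] would be at least
   [c] everywhere; but a third member [H k] dominates that mean and drops below [c] somewhere. *)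
have pair i j : exists x, [/\ unitI x, H i x <= c%:E & H j x <= c%:E].
  apply: contrapT => nex.
  have dis x : unitI x -> ~ (H i x <= c%:E /\ H j x <= c%:E).
    by move=> x1 [hi hj]; apply: nex; exists x.
  have [ai ai1 Hai] := Hlt i; have [aj aj1 Haj] := Hlt j.
  have : exists2 t, unitI t & forall x, unitI x -> c%:E <= t%:E * H i x + (1 - t)%:E * H j x.
    have [aij|aji|aij] := ltgtP ai aj.
    - by apply: (two_functions_minimax (H0 i) (H0 j) _ _ _ _ dis ai1 aj1).
    - have dis' x : unitI x -> ~ (H j x <= c%:E /\ H i x <= c%:E).
        by move=> x1 [hj hi]; exact: (dis x).
      have [t /andP[t0 t1] h] := two_functions_minimax (H0 j) (H0 i) (Hc j) (Hc i) (Hf i) (Hl j) dis' aj1 ai1 Haj Hai aji.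
      exists (1 - t)%R; first by rewrite /unitI/= subr_ge0 t1/= gerBl.
      by move=> x x1; rewrite subKr addeC; exact: h.
    - by exfalso; apply: (dis ai ai1); split; apply: ltW => //; rewrite aij.
  case=> t t1 h; have [k hk] := Hk i j t t1; have [a a1 Hka] := Hlt k.
  by have := lt_le_trans Hka (le_trans (h a a1) (hk a a1)); rewrite ltxx.
have [[i0]|noI] := pselect (inhabited I); last first.
  by exists 0%R => [|i]; [rewrite /unitI/= lexx ler01|exfalso; apply: noI;
    constructor].
pose K i := [set a | unitI a /\ H i a <= c%:E].
have K0 i : K i !=set0 by have [a a1 /ltW Ha] := Hlt i; exists a.
pose B := [set sup (K i) | i in [set: I]].
have B0 : B !=set0 by exists (sup (K i0)); exists i0.
have Bl : has_lbound B.
  by exists 0%R => _ [i _ <-]; have [/andP[]] := sublevel_sup (Hl i) (K0 i).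
pose a := inf B.
suff aK i : K i a by exists a => [|i]; [case: (aK i0)|case: (aK i)].
have [b1 Hb Kb] := sublevel_sup (Hl i) (K0 i); set b := sup _ in b1 Hb Kb.
have ab : (a <= b)%R by apply: ge_inf => //; exists i.
(* Some [K j] ends just above [a], so its common point [x] with [K i] is either just above [a] or at
   most [a]; in the latter case [a] lies between [x] and [b] and belongs to [K i]. Closedness then
   puts [a] in every [K i]. *)
have ex n : {x | K i x & `|x - a| < n.+1%:R^-1}%R.
  apply: cid2; have n0 : (0 < n.+1%:R^-1 :> R)%R by [].
  have [|_ [j _ <-] sa] := inf_adherent n0 (E := B); first by split.
  have [x [x1 Hix Hjx]] := pair i j.
  have [_ _ Kj] := sublevel_sup (Hl j) (K0 j).
  have xs : (x < a + n.+1%:R^-1)%R by rewrite (le_lt_trans (Kj _ x1 Hjx)).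
  have [xa|ax] := leP x a.
    exists a; last by rewrite subrr normr0.
    split; last by apply: (@cvx01_le _ x b) => //; rewrite xa.
    by rewrite /unitI/=; case/andP : x1 => x0 _; case/andP : b1 => _ b1;
      rewrite (le_trans x0 xa)/= (le_trans ab).
  by exists x => //; rewrite gtr0_norm ?subr_gt0// ltrBlDl.
pose x n := s2val (ex n).
have xK n : K i (x n) := s2valP (ex n).
have xs : x @ \oo --> a by apply: adherent_cvg => n; exact: (s2valP' (ex n)).
split; first by apply: unitI_cvg xs => n; case: (xK n).
by apply: (Hl i) xs _ => n; case: (xK n).
Qed.

End minimax.

(** * Measures with densities and sequence spaces *)

Section densities.
Context d (T : measurableType d) (R : realType).

Lemma integral_restrict_indic (mu : {measure set T -> \bar R}) (A : set T) (f : T -> \bar R) :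
  \int[mu]_(x in A) f x = \int[mu]_x ((\1_A x)%:E * f x).
Proof.
rewrite integral_mkcond; apply: eq_integral => x _.
by rewrite /patch indicE; case: ifP; rewrite ?mul1e ?mul0e.
Qed.

Import HBNNSimple.

(** Both sides are limits along the same simple functions increasing to [g], and on each fibre of a
    simple function the claim is the hypothesis on [nu]. *)
Lemma ge0_integral_density (mu nu : {measure set T -> \bar R}) (f : T -> R) (g : T -> \bar R) :
  measurable_fun setT f -> (forall x, (0 <= f x)%R) ->
  (forall A, measurable A -> nu A = \int[mu]_(x in A) (f x)%:E) ->
  measurable_fun setT g -> (forall x, 0 <= g x) ->
  \int[nu]_x g x = \int[mu]_x (g x * (f x)%:E).
Proof.
move=> mf f0 nuE mg g0; pose g_ := nnsfun_approx measurableT mg.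
have mgf n : measurable_fun setT (fun x => (g_ n x)%:E * (f x)%:E).
  by apply: emeasurable_funM; exact/measurable_EFinP.
have gf0 n x : 0 <= (g_ n x)%:E * (f x)%:E by rewrite mule_ge0 ?lee_fin.
transitivity (limn (fun n => \int[nu]_x (g_ n x)%:E)).
  rewrite -monotone_convergence//.
  - by apply: eq_integral => y _; apply/esym/cvg_lim => //;
    exact: cvg_nnsfun_approx.
  - by move=> n; exact/measurable_EFinP.
  - by move=> n y _; rewrite lee_fin.
  - by move=> y _ m n mn; rewrite lee_fin; exact/lefP/nd_nnsfun_approx.
transitivity (limn (fun n => \int[mu]_x ((g_ n x)%:E * (f x)%:E))); last first.
  rewrite -monotone_convergence//.
  - apply: eq_integral => y _; apply/cvg_lim => //.
    apply: cvgeZr => //; exact: cvg_nnsfun_approx.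
  - by move=> y _ m n mn; rewrite lee_wpmul2r ?lee_fin//;
    exact/lefP/nd_nnsfun_approx.
congr (limn _); apply/funext => n.
have mfib r : measurable (g_ n @^-1` [set r]) by [].
transitivity (\sum_(r \in range (g_ n)) \int[nu]_x (r * \1_(g_ n @^-1` [set r]) x)%:E).
  rewrite -ge0_integral_fsum//.
  - by apply: eq_integral => x _; rewrite fimfunE -fsumEFin.
  - by move=> r; exact/measurable_EFinP/measurable_funM.
  - by move=> r x _; rewrite nnfun_muleindic_ge0.
transitivity (\sum_(r \in range (g_ n))
    \int[mu]_x ((r * \1_(g_ n @^-1` [set r]) x)%:E * (f x)%:E)); last first.
  rewrite -ge0_integral_fsum//.
  - apply: eq_integral => x _; rewrite [in RHS]fimfunE -fsumEFin//.
    by rewrite ge0_mule_fsuml// => r; exact: nnfun_muleindic_ge0.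
  - by move=> r; apply: emeasurable_funM;
    [exact/measurable_EFinP/measurable_funM|exact/measurable_EFinP].
  - by move=> r x _; apply: mule_ge0; [exact: nnfun_muleindic_ge0|rewrite lee_fin].
apply: eq_fsbigr => r /[!inE] -[x _ rE].
have r0 : (0 <= r)%R by rewrite -rE.
under eq_integral do rewrite EFinM.
under [RHS]eq_integral do rewrite EFinM -muleA.
rewrite !ge0_integralZl//.
- by rewrite integral_indic// setIT nuE// integral_restrict_indic.
- by apply: emeasurable_funM; exact/measurable_EFinP.
- by move=> y _; rewrite mule_ge0 ?lee_fin.
- exact/measurable_EFinP.
Qed.

Lemma density_probability (mu : {measure set T -> \bar R}) (f : T -> R) :
  measurable_fun setT f -> (forall x, (0 <= f x)%R) -> \int[mu]_x (f x)%:E = 1 ->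
  exists nu : probability T R, forall A, nu A = \int[mu]_(x in A) (f x)%:E.
Proof.
move=> mf f0 f1; pose m A := \int[mu]_(x in A) (f x)%:E.
have m0 : m set0 = 0 by rewrite /m integral_set0.
have mge0 A : 0 <= m A by apply: integral_ge0 => x _; rewrite lee_fin.
have madd : semi_sigma_additive m.
  move=> /= A mA tA mUA; rewrite /m ge0_integral_bigcup//.
  - by apply: is_cvg_nneseries => n _ _; exact: mge0.
  - exact/measurable_EFinP/measurable_funTS.
  - by move=> x _; rewrite lee_fin.
pose m_mixin := isMeasure.Build _ _ _ m m0 mge0 madd.
pose m_measure : {measure set T -> \bar R} := HB.pack m m_mixin.
pose p_mixin := Measure_isProbability.Build _ _ _ m_measure f1.
pose m_prob : probability T R := HB.pack m m_measure p_mixin.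
by exists m_prob.
Qed.

(** A Bernoulli law pushed forward to [a] and [b]. It produces the two-point mixtures of the minimax
    argument. *)
Lemma two_point_probability (t : R) (a b : T) : (0 <= t <= 1)%R ->
  exists2 nu : probability T R,
    (forall A, measurable A -> A a -> A b -> nu A = 1) &
    forall g : T -> \bar R, measurable_fun setT g -> (forall x, 0 <= g x) ->
      \int[nu]_x g x = t%:E * g a + (1 - t)%:E * g b.
Proof.
move=> t01; pose phi (c : bool) := if c then a else b.
have mphi : measurable_fun setT phi by [].
pose phim : {RV (bernoulli_prob t) >-> T} := HB.pack phi (isMeasurableFun.Build _ _ _ _ _ mphi).
exists (distribution (bernoulli_prob t) phim).
  move=> A mA Aa Ab; rewrite /distribution /pushforward -[RHS](probability_setT (bernoulli_prob t)).
  by congr (bernoulli_prob t _); apply/seteqP; split => // -[].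
move=> g mg g0; rewrite ge0_integral_distribution// integral_bernoulli_prob// => x;
  exact: g0.
Qed.

End densities.

Section sequence_space.
Context d (Y : measurableType d) (R : realType).

Definition cylinder n (B : nat -> set Y) : set (nat -> Y) :=
  [set x | forall i, (i < n)%N -> B i (x i)].

Definition cylinders : set (set (nat -> Y)) :=
  [set C | exists n B, (forall i, measurable (B i)) /\ C = cylinder n B].

Definition seqspace := g_sigma_algebraType cylinders.

HB.instance Definition _ := Measurable.on seqspace.

Lemma measurable_cylinder n B : (forall i, measurable (B i)) ->
  measurable (cylinder n B : set seqspace).
Proof. by move=> mB; apply: sub_sigma_algebra; exists n, B. Qed.

Lemma measurable_coord i : measurable_fun setT (fun x : seqspace => x i).
Proof.
move=> _ B mB; rewrite setTI.
rewrite (_ : _ @^-1` _ = cylinder i.+1 (fun j => if j == i then B else setT)).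
  by apply: measurable_cylinder => j; case: ifP.
apply/seteqP; split => x /= h.
  by move=> j _; case: eqP => [->|].
by have := h i (ltnSn _); rewrite eqxx.
Qed.

Lemma measurable_to_seqspace d' (S : measurableType d') (f : S -> seqspace) :
  (forall i, measurable_fun setT (fun s => f s i)) -> measurable_fun setT f.
Proof.
move=> mf; apply: (@measurability _ _ S seqspace setT f cylinders) => //.
move=> _ [_ [n [B [mB ->]]] <-].
rewrite setTI (_ : _ @^-1` _ = \bigcap_(i in [set i | (i < n)%N]) ((fun s => f s i) @^-1` B i)).
  apply: bigcap_measurableType => i _.
  by rewrite -[X in measurable X]setTI; exact: mf.
by apply/seteqP; split => s /= h i; exact: h.
Qed.

Definition scons (z : Y * seqspace) : seqspace :=
  fun i => if i is j.+1 then z.2 j else z.1.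

Lemma measurable_scons : measurable_fun setT scons.
Proof.
apply: measurable_to_seqspace => -[|i] /=; first exact: measurable_fst.
exact: (measurableT_comp (measurable_coord i) measurable_snd).
Qed.

Variables (Q : probability Y R) (Lam : probability seqspace R).
Hypothesis Lam_cylinder : forall n B, (forall i, measurable (B i)) ->
  Lam (cylinder n B) = \prod_(i < n) Q (B i).

(** The law of [scons] under the product of [Q] and [Lam] agrees with [Lam] on cylinders, which form
    a generating class closed under intersection; Tonelli does the rest. *)
Lemma ge0_integral_scons (F : seqspace -> \bar R) :
  measurable_fun setT F -> (forall x, 0 <= F x) ->
  \int[Lam]_x F x = \int[Q]_y \int[Lam]_x F (scons (y, x)).
Proof.
move=> mF F0.
pose sconsm : {RV (Q \x Lam)%E >-> seqspace} := HB.pack scons (isMeasurableFun.Build _ _ _ _ _ measurable_scons).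
transitivity (\int[distribution (Q \x Lam)%E sconsm]_x F x).
  apply: eq_measure_integral => A mA _.
  apply: (@measure_unique _ R seqspace cylinders (fun=> setT)) => //.
  - move=> _ _ [n [B [mB ->]]] [m [C [mC ->]]].
    (* The shorter cylinder is padded with [setT]. *)
    exists (maxn n m), (fun i => (if (i < n)%N then B i else setT) `&` (if (i < m)%N then C i else setT)).
    split; first by move=> i; apply: measurableI; case: ifP.
    apply/seteqP; split => x /=.
      by move=> [h1 h2] i _; split; case: ifP => // ?; [exact: h1|exact: h2].
    move=> h; split => i im.
      by have [] := h i (leq_trans im (leq_maxl _ _)); rewrite im.
    by have [] := h i (leq_trans im (leq_maxr _ _)); rewrite im.
  - by move=> _; exists 0%N, (fun=> setT); split => //; apply/seteqP; split.
  - by rewrite bigcup_const//; exists 0%N.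
  - move=> _ [n [B [mB ->]]]; case: n => [|n].
      have -> : cylinder 0 B = setT by apply/seteqP; split.
      exact: etrans (probability_setT Lam) (esym (probability_setT (distribution (Q \x Lam)%E sconsm))).
    transitivity (\prod_(i < n.+1) Q (B i)); first exact: Lam_cylinder.
    transitivity ((Q \x Lam)%E (B 0%N `*` (cylinder n (fun i => B i.+1) : set seqspace))).
      rewrite product_measure1E//; last exact: measurable_cylinder.
      rewrite big_ord_recl; congr (_ * _); apply/esym.
      exact: (Lam_cylinder n (fun i => mB i.+1)).
    congr ((Q \x Lam)%E _); apply/seteqP; split => -[y x] /=.
      by move=> [h0 h] [|i] //= im; exact: h.
    by move=> h; split => [|i im]; [exact: (h 0%N)|exact: (h i.+1)].
  - by move=> k; apply: (@le_lt_trans _ _ 1); [exact: probability_le1|rewrite ltry].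
rewrite ge0_integral_distribution// fubini_tonelli1//.
- by apply: measurableT_comp => //; exact: measurable_scons.
- by move=> z; exact: F0.
Qed.

End sequence_space.

(** * Moments of restricted likelihoods *)

Section extended_power.
Context {R : realType}.

(* erpow +oo a = +oo even for a = 0, so that moment bounds hold trivially where
   a likelihood is infinite. *)
Definition erpow (x : \bar R) (a : R) : \bar R :=
  if x is r%:E then (rpow r a)%:E else +oo.

Lemma erpow_ge0 x a : 0 <= erpow x a.
Proof. by case: x => [r| |] //=; rewrite lee_fin rpow_ge0. Qed.

Lemma measurable_erpow a : measurable_fun setT (fun x : \bar R => erpow x a).
Proof.
rewrite (_ : (fun x => _) = fun x => if (x == +oo) || (x == -oo) then +oo else (rpow (fine x) a)%:E).
  apply: measurable_fun_if => //.
  - by apply: measurable_or; apply: measurable_fun_eqe.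
  - apply: measurable_funTS; apply/measurable_EFinP.
    by apply: (measurableT_comp (measurable_rpow a)); exact: fine_measurable.
by apply/funext => -[r| |].
Qed.

End extended_power.

Section moments.
Context dY dT (Y : measurableType dY) (T : measurableType dT) (R : realType).
Variables (Q : probability Y R) (q : T -> Y -> R).
Hypothesis q0 : forall t y, (0 <= q t y)%R.
Hypothesis mq : measurable_fun setT (fun z : T * Y => q z.1 z.2).

Lemma measurable_section1 t : measurable_fun setT (q t).
Proof. exact: (measurable_fun_pair2 t mq). Qed.

Lemma measurable_section2 y : measurable_fun setT (q^~ y).
Proof. exact: (measurable_fun_pair1 y mq). Qed.

(** At [a = 0] this is the probability that [q t] is nonzero, which may be less than 1. *)
Definition rmoment t a : \bar R := \int[Q]_y (rpow (q t y) a)%:E.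

Lemma measurable_rpow_section t a : measurable_fun setT (fun y => (rpow (q t y) a)%:E).
Proof. by apply/measurable_EFinP/(measurableT_comp (measurable_rpow a));
  exact: measurable_section1. Qed.

#[local] Hint Resolve measurable_rpow_section : core.

Lemma rpow_section_ge0 t a y : 0 <= (rpow (q t y) a)%:E.
Proof. by rewrite lee_fin rpow_ge0. Qed.

#[local] Hint Resolve rpow_section_ge0 : core.

Lemma rmoment_ge0 t a : 0 <= rmoment t a.
Proof. by apply: integral_ge0 => y _. Qed.

Lemma integral_rpow_comb s t (u v a b : R) : (0 <= u)%R -> (0 <= v)%R ->
  u%:E * rmoment s a + v%:E * rmoment t b =
  \int[Q]_y (u * rpow (q s y) a + v * rpow (q t y) b)%:E.
Proof.
move=> u0 v0; under [RHS]eq_integral do rewrite EFinD !EFinM.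
rewrite ge0_integralD//.
- by rewrite !ge0_integralZl_EFin.
- by move=> y _; rewrite mule_ge0.
- by apply: emeasurable_funM.
- by move=> y _; rewrite mule_ge0.
- by apply: emeasurable_funM.
Qed.

Lemma measurable_rpow_comb s t (u v a b : R) :
  measurable_fun setT (fun y => (u * rpow (q s y) a + v * rpow (q t y) b)%:E).
Proof.
by apply/measurable_EFinP/measurable_funD; apply: measurable_funM => //;
  exact: (measurableT_comp (measurable_rpow _) (measurable_section1 _)).
Qed.

#[local] Hint Resolve measurable_rpow_comb : core.

Lemma rmoment_cvx t : cvx01 (rmoment t).
Proof.
move=> a b th a1 b1 /andP[t0 t1]; rewrite integral_rpow_comb ?subr_ge0//.
apply: ge0_le_integral => // y _; rewrite lee_fin rpow_conv//; exact/andP.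
Qed.

Lemma rmoment_finite_below t : finite_below (rmoment t).
Proof.
move=> a b a0 ab b1 h; apply: (@le_lt_trans _ _ (\int[Q]_y (1 + (rpow (q t y) b)%:E))).
  apply: ge0_le_integral => //; first by apply: emeasurable_funD.
  by move=> y _; rewrite -EFinD lee_fin rpow_le1D.
rewrite ge0_integralD// integral_cst// mul1e.
by apply: lte_add_pinfty => //; apply: (@le_lt_trans _ _ 1);
  [exact: probability_le1|exact: ltry].
Qed.

(** Fatou's lemma along the exponents; [rpow] is continuous in the exponent, 0 included. *)
Lemma rmoment_lsc t : seq_lsc (rmoment t).
Proof.
move=> x a c x1 xa hc.
have E y : (rpow (q t y) a)%:E = limn_einf (fun n => (rpow (q t y) (x n))%:E).
  apply/esym/(cvg_limn_einf_sup _).1; apply: cvg_EFin; first by near=> n.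
  exact: cvg_rpow.
rewrite /rmoment; under eq_integral do rewrite E.
apply: (le_trans (fatou _ _ _ _)) => //.
rewrite limn_einf_lim; apply: lime_le; first exact: is_cvg_einfs.
near=> n; apply: le_trans (hc n); apply: ereal_inf_lbound; exists n => //=.
Unshelve. all: by end_near.
Qed.

(** The counterpart of [mixture_convex] for the ratios [q] instead of the densities, with equality
    almost everywhere under the true law [Q] only. *)
Definition mix_closed (A : set T) := forall nu : probability T R, nu A = 1 ->
  exists2 t, A t & {ae Q, forall y, (q t y)%:E = \int[nu]_s (q s y)%:E}.

(** The two-point mixture serves as [k] for all exponents at once, by concavity of the powers. *)
Lemma rmoment_mix A s t th : measurable A -> mix_closed A -> A s -> A t -> unitI th ->
  exists2 k, A k & forall a, unitI a ->
    th%:E * rmoment s a + (1 - th)%:E * rmoment t a <= rmoment k a.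
Proof.
move=> mA cA As At th1; have /andP[th0 th1'] := th1.
have [nu nuA nuE] := @two_point_probability _ T R th s t th1.
have [k Ak kE] := cA nu (nuA A mA As At); exists k => // a a1.
rewrite integral_rpow_comb ?subr_ge0//; apply: ae_ge0_le_integral => //.
- by move=> y _; rewrite lee_fin addr_ge0// mulr_ge0 ?rpow_ge0 ?subr_ge0.
- apply: filterS kE => y + _.
  rewrite nuE; [|exact/measurable_EFinP/measurable_section2|by move=> s';
    rewrite lee_fin].
  rewrite -!EFinM -EFinD => -[->]; rewrite lee_fin; exact: rpow_concave.
Qed.

(** The quantifiers over [t] and [a] are exchanged by [minimax01], at the cost of a non-strict
    bound. *)
Lemma uniform_exponent A (c : R) : measurable A -> mix_closed A ->
  (forall t, A t -> exists2 a, unitI a & rmoment t a < c%:E) ->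
  exists2 a, unitI a & forall t, A t -> rmoment t a <= c%:E.
Proof.
move=> mA cA lA.
have [||||||a a1 h] := @minimax01 R {t | A t} (fun t => rmoment (sval t)) c.
- by move=> i a; exact: rmoment_ge0.
- by move=> i; exact: rmoment_cvx.
- by move=> i; exact: rmoment_finite_below.
- by move=> i; exact: rmoment_lsc.
- move=> [s As] [t At] th th1; have [k Ak h] := rmoment_mix mA cA As At th1.
  by exists (exist _ k Ak).
- by move=> [t At]; exact: lA.
by exists a => // t At; exact: (h (exist _ t At)).
Qed.

Variable Pi : probability T R.

Lemma measurable_weighted_likelihood A (k : T -> R) : measurable A -> measurable_fun setT k ->
  (forall t, (0 <= k t)%R) ->
  measurable_fun setT (fun y => \int[Pi]_(t in A) (k t * q t y)%:E).
Proof.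
move=> mA mk k0.
rewrite (_ : (fun y => _) = fubini_G Pi (fun z : T * Y => (\1_A z.1 * (k z.1 * q z.1 z.2))%:E)); last first.
  by apply/funext => y; rewrite integral_restrict_indic.
apply: measurable_fun_fubini_tonelli_G.
- apply/measurable_EFinP; apply: measurable_funM.
    by apply: (measurableT_comp _ measurable_fst); exact: measurable_indic.
  by apply: measurable_funM => //; exact: (measurableT_comp mk measurable_fst).
- by move=> z; rewrite lee_fin !mulr_ge0.
Qed.

(* The weight k, normalized, is a probability on A; its mixture is a member of A,
   to which the moment bound applies. *)
Lemma likelihood_step A (a c : R) (k : T -> R) : measurable A -> mix_closed A -> unitI a ->
  (0 < c)%R -> (forall t, A t -> rmoment t a <= c%:E) ->
  measurable_fun setT k -> (forall t, (0 <= k t)%R) ->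
  \int[Q]_y erpow (\int[Pi]_(t in A) (k t * q t y)%:E) a <=
    c%:E * erpow (\int[Pi]_(t in A) (k t)%:E) a.
Proof.
move=> mA cA a1 c0 hc mk k0.
have L0 : 0 <= \int[Pi]_(t in A) (k t)%:E by apply: integral_ge0 => t _;
  rewrite lee_fin.
have mkA : measurable_fun setT (fun t => k t * \1_A t)%R.
  by apply: measurable_funM => //; exact: measurable_indic.
case LE : (\int[Pi]_(t in A) (k t)%:E) L0 => [l| |] //; last first.
  by rewrite gt0_muley ?leey// lte_fin.
(* If [l = 0], the weight cannot be normalized; but then [k] vanishes almost everywhere on [A] and
   both sides are 0, even for [a = 0] since [rpow 0 0 = 0]. *)
rewrite lee_fin le0r => /orP[/eqP l0|l0].
  have kA0 : ae_eq Pi A (fun t => (k t)%:E) (cst 0).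
    apply/ae_eq_integral_abs => //; first exact/measurable_EFinP/measurable_funTS.
    transitivity (\int[Pi]_(t in A) (k t)%:E); last by rewrite LE l0.
    apply: eq_integral => t _.
    by rewrite gee0_abs// lee_fin.
  have zero y : \int[Pi]_(t in A) (k t * q t y)%:E = 0.
    rewrite -(integral0 Pi A); apply: ae_eq_integral => //.
    - apply/measurable_EFinP/measurable_funTS/measurable_funM => //.
      exact: measurable_section2.
    - by apply: filterS kA0 => t /= + At => /(_ At) [->]; rewrite mul0r.
  by rewrite l0/=; under eq_integral do rewrite zero /= rpow0;
    rewrite integral0 rpow0 mule0.
have [||| nu nuE] := @density_probability _ T R Pi (fun t => k t * \1_A t / l)%R.
- exact: measurable_funM.
- by move=> t; rewrite divr_ge0 ?mulr_ge0 ?(ltW l0).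
- under eq_integral do rewrite mulrAC mulrC EFinM.
  rewrite -integral_restrict_indic.
  under eq_integral do rewrite mulrC EFinM.
  rewrite ge0_integralZl_EFin ?LE ?invr_ge0 ?(ltW l0)//.
  + by rewrite -EFinM mulVf// gt_eqF.
  + by move=> t _; rewrite lee_fin.
  + exact/measurable_EFinP/measurable_funTS.
have nuA : nu A = 1.
  rewrite nuE integral_restrict_indic.
  transitivity (\int[Pi]_t (l^-1%:E * ((\1_A t)%:E * (k t)%:E))).
    apply: eq_integral => t _; rewrite -!EFinM; congr EFin.
    by rewrite indicE; case: (t \in A) => /=; ring.
  rewrite ge0_integralZl_EFin ?invr_ge0 ?(ltW l0)//.
  + by rewrite -integral_restrict_indic LE -EFinM mulVf// gt_eqF.
  + by move=> t _; rewrite mule_ge0 ?lee_fin.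
  + by apply: emeasurable_funM; apply/measurable_EFinP => //;
    exact: measurable_indic.
have [t0 At0 t0E] := cA nu nuA.
have E y : \int[nu]_s (q s y)%:E = l^-1%:E * \int[Pi]_(t in A) (k t * q t y)%:E.
  transitivity (\int[Pi]_s ((q s y)%:E * (k s * \1_A s / l)%:E)).
    apply: ge0_integral_density => //.
    - exact: measurable_funM.
    - by move=> t; rewrite divr_ge0 ?mulr_ge0 ?(ltW l0).
    - by move=> B _; exact: nuE.
    - exact/measurable_EFinP/measurable_section2.
    - by move=> t; rewrite lee_fin.
  transitivity (\int[Pi]_s (l^-1%:E * ((\1_A s)%:E * (k s * q s y)%:E))).
    by apply: eq_integral => t _; rewrite -!EFinM; congr EFin; ring.
  rewrite ge0_integralZl_EFin ?invr_ge0 ?(ltW l0)//.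
  - by rewrite -integral_restrict_indic.
  - by move=> t _; rewrite mule_ge0 ?lee_fin// mulr_ge0.
  - apply: emeasurable_funM; apply/measurable_EFinP; first exact: measurable_indic.
    by apply: measurable_funM => //; exact: measurable_section2.
have ae_mix : {ae Q, forall y, \int[Pi]_(t in A) (k t * q t y)%:E = (l * q t0 y)%:E}.
  apply: filterS t0E => y; rewrite E => h.
  by rewrite EFinM h muleA -EFinM mulfV ?gt_eqF// mul1e.
have mW := measurable_weighted_likelihood mA mk k0.
rewrite (@ge0_ae_eq_integral _ _ _ Q setT _ (fun y => (rpow l a)%:E * (rpow (q t0 y) a)%:E))//.
- rewrite ge0_integralZl_EFin ?rpow_ge0// muleC /=.
  by apply: lee_wpmul2r; [rewrite lee_fin rpow_ge0|exact: hc].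
- exact: (measurableT_comp (measurable_erpow a) mW).
- exact: emeasurable_funM.
- by move=> y _; exact: erpow_ge0.
- by move=> y _; rewrite mule_ge0 ?lee_fin ?rpow_ge0.
- by apply: filterS ae_mix => y -> _; rewrite /= rpowM ?(ltW l0)// EFinM.
Qed.

(** The weight [k] has two uses: as a function it carries observations already absorbed, as a
    constant it rescales the likelihood before a power is taken. *)
Definition likelihood A n (k : T -> R) (x : seqspace Y) : \bar R :=
  \int[Pi]_(t in A) (k t * \prod_(i < n) q t (x i))%:E.

Lemma measurable_joint_likelihood n (k : T -> R) : measurable_fun setT k ->
  measurable_fun setT (fun z : seqspace Y * T => k z.2 * \prod_(i < n) q z.2 (z.1 i))%R.
Proof.
move=> mk; apply: measurable_funM; first exact: (measurableT_comp mk measurable_snd).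
apply: measurable_prod => i _.
apply: (measurableT_comp (f := fun z : T * Y => q z.1 z.2) (g := fun z : seqspace Y * T => (z.2, z.1 i))) => //.
apply: measurable_fun_pair; first exact: measurable_snd.
exact: (measurableT_comp (measurable_coord i) measurable_fst).
Qed.

Lemma measurable_likelihood A n (k : T -> R) : measurable A -> measurable_fun setT k ->
  (forall t, (0 <= k t)%R) -> measurable_fun setT (likelihood A n k).
Proof.
move=> mA mk k0.
rewrite (_ : likelihood A n k = fubini_F Pi (fun z : seqspace Y * T =>
    (\1_A z.2 * (k z.2 * \prod_(i < n) q z.2 (z.1 i)))%:E)); last first.
  by apply/funext => x; rewrite /likelihood integral_restrict_indic.
apply: measurable_fun_fubini_tonelli_F.
- apply/measurable_EFinP; apply: measurable_funM.
    by apply: (measurableT_comp _ measurable_snd); exact: measurable_indic.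
  exact: measurable_joint_likelihood.
- by move=> z; rewrite lee_fin !mulr_ge0// prodr_ge0.
Qed.

Variable Lam : probability (seqspace Y) R.
Hypothesis Lam_cylinder : forall n B, (forall i, measurable (B i)) ->
  Lam (cylinder n B) = \prod_(i < n) Q (B i).

(* The induction peels off the first observation, which is absorbed in k. *)
Lemma likelihood_moment A (a c : R) : measurable A -> mix_closed A -> unitI a ->
  (0 < c)%R -> (forall t, A t -> rmoment t a <= c%:E) ->
  forall n (k : T -> R), measurable_fun setT k -> (forall t, (0 <= k t)%R) ->
  \int[Lam]_x erpow (likelihood A n k x) a <=
    (c ^+ n)%:E * erpow (\int[Pi]_(t in A) (k t)%:E) a.
Proof.
move=> mA cA a1 c0 hc; elim => [|n IHn] k mk k0.
  rewrite expr0 mul1e /likelihood.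
  under eq_integral => x _ do under eq_integral => t _ do rewrite big_ord0 mulr1.
  rewrite integral_cst//.
  apply: (@le_trans _ _ (erpow (\int[Pi]_(t in A) (k t)%:E) a * 1));
    last by rewrite mule1.
  by apply: lee_wpmul2l; [exact: erpow_ge0|exact: probability_le1].
rewrite (ge0_integral_scons Lam_cylinder); last 2 first.
  by apply: (measurableT_comp (measurable_erpow a)); exact: measurable_likelihood.
  by move=> x; exact: erpow_ge0.
apply: (@le_trans _ _ (\int[Q]_y ((c ^+ n)%:E * erpow (\int[Pi]_(t in A) (k t * q t y)%:E) a))).
  apply: ge0_le_integral => //.
  - by move=> y _; apply: integral_ge0 => x _; exact: erpow_ge0.
  - apply: (measurable_fun_fubini_tonelli_F (fun z => erpow (likelihood A n.+1 k (scons z)) a)).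
      apply: (measurableT_comp (measurable_erpow a)).
      by apply: (measurableT_comp _ (@measurable_scons _ _));
        exact: measurable_likelihood.
    by move=> z; exact: erpow_ge0.
  - apply: emeasurable_funM => //; apply: (measurableT_comp (measurable_erpow a)).
    exact: measurable_weighted_likelihood.
  - move=> y _; apply: le_trans (IHn (fun t => k t * q t y)%R _ _).
    + under eq_integral => x _.
        rewrite (_ : likelihood A n.+1 k (scons (y, x)) = likelihood A n (fun t => k t * q t y)%R x); last first.
          by apply: eq_integral => t _; rewrite big_ord_recl /= mulrA.
        over.
      by [].
    + by apply: measurable_funM => //; exact: measurable_section2.
    + by move=> t; rewrite mulr_ge0.
rewrite ge0_integralZl_EFin//.
- rewrite exprSr EFinM -muleA; apply: lee_wpmul2l;
  first by rewrite lee_fin exprn_ge0// ltW.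
  exact: likelihood_step.
- by move=> y _; exact: erpow_ge0.
- apply: (measurableT_comp (measurable_erpow a)).
  exact: measurable_weighted_likelihood.
- by rewrite exprn_ge0// ltW.
Qed.

End moments.

(** * Random walks with negative drift *)

Section random_walk.
Context d (Y : measurableType d) (R : realType).
Variables (Q : probability Y R) (Lam : probability (seqspace Y) R).
Hypothesis Lam_cylinder : forall n B, (forall i, measurable (B i)) ->
  Lam (cylinder n B) = \prod_(i < n) Q (B i).

Lemma integral_probability_cst d' (S : measurableType d') (P : probability S R) (r : \bar R) :
  \int[P]_x r = r.
Proof.
rewrite integral_cst// -[RHS]mule1; congr (_ * _); exact: probability_setT.
Qed.

Definition stail (x : seqspace Y) : seqspace Y := fun i => x i.+1.

Lemma measurable_stail : measurable_fun setT stail.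
Proof. by apply: measurable_to_seqspace => i; exact: measurable_coord. Qed.

(** The maximum of the partial sums of order 0 to [n], the empty sum included, written recursively
    through the shift as the maximal ergodic lemma uses it. *)
Fixpoint maxwalk (Z : Y -> R) n (x : seqspace Y) : R :=
  if n is m.+1 then Num.max 0%R (Z (x 0%N) + maxwalk Z m (stail x))%R else 0%R.

Lemma maxwalk_ge0 Z n x : (0 <= maxwalk Z n x)%R.
Proof. by case: n => //= n; rewrite le_max lexx. Qed.

Lemma maxwalk_nd Z n x : (maxwalk Z n x <= maxwalk Z n.+1 x)%R.
Proof.
elim: n x => [|n IHn] x /=; first by rewrite le_max lexx.
by rewrite ge_max le_max lexx/= le_max lerD2l IHn orbT.
Qed.

Lemma maxwalk_homo Z x m n : (m <= n)%N -> (maxwalk Z m x <= maxwalk Z n x)%R.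
Proof. exact: (homo_leq (fun x => lexx x) (fun y x z => @le_trans _ _ y x z) (fun n => maxwalk_nd Z n x)). Qed.

Lemma walk_le_maxwalk Z n (x : seqspace Y) : (\sum_(i < n) Z (x i) <= maxwalk Z n x)%R.
Proof.
elim: n x => [|n IHn] x /=; first by rewrite big_ord0.
by rewrite big_ord_recl /= le_max lerD2l (IHn (stail x)) orbT.
Qed.

Lemma measurable_maxwalk Z n : measurable_fun setT Z -> measurable_fun setT (maxwalk Z n).
Proof.
move=> mZ; elim: n => [|n IHn] //=.
apply: measurable_maxr => //; apply: measurable_funD.
  exact: (measurableT_comp mZ (measurable_coord 0)).
exact: (measurableT_comp IHn measurable_stail).
Qed.

Definition unbounded_walk (Z : Y -> R) : set (seqspace Y) :=
  \bigcap_(m in [set: nat]) \bigcup_(n in [set: nat]) [set x | (m%:R < maxwalk Z n x)%R].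

Lemma measurable_maxwalk_gt Z n (r : R) : measurable_fun setT Z ->
  measurable [set x | (r < maxwalk Z n x)%R].
Proof.
move=> mZ; rewrite -[X in measurable X]setTI (_ : [set x | _] = maxwalk Z n @^-1` `]r, +oo[).
  exact: measurable_maxwalk.
by apply/seteqP; split => x /=; rewrite in_itv/= andbT.
Qed.

Lemma measurable_unbounded_walk Z : measurable_fun setT Z -> measurable (unbounded_walk Z).
Proof.
move=> mZ; apply: bigcap_measurableType => m _.
by apply: bigcup_measurable => n _; exact: measurable_maxwalk_gt.
Qed.

(** Dropping the first step changes the later partial sums by the fixed amount [Z y]. This half of
    shift invariance is what [maxwalk_drift] needs. *)
Lemma unbounded_walk_scons Z y x : unbounded_walk Z (scons (y, x)) -> unbounded_walk Z x.
Proof.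
move=> h m _; have [n _ /=] := h (m + Num.truncn `|Z y|).+1 I.
case: n => [|n] /=; first by rewrite ltNge ler0n.
rewrite lt_max ltNge ler0n/= => hn; exists n => //=.
rewrite -[stail _]/x in hn.
have := truncnS_gt `|Z y|; have := ler_norm (Z y); move: hn.
rewrite -addnS natrD; lra.
Qed.

(** In the recursion, the truncation at 0 acts only if the previous maximum is below [- Z y], hence
    below [m0], and it then costs at most [m0]. Positive and negative parts of [Z y] stand on
    opposite sides so that no difference of integrals arises later. *)
Lemma maxwalk_scons_le (m0 : R) Z n y x : (0 <= m0)%R -> (- m0 <= Z y)%R ->
  (maxwalk Z n.+1 (scons (y, x)) + Num.max (- Z y) 0 <=
   maxwalk Z n x + Num.max (Z y) 0 + m0 * \1_[set x | (maxwalk Z n x < m0)%R] x)%R.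
Proof.
move=> m00 Zm /=; rewrite -[stail _]/x.
have M0 := maxwalk_ge0 Z n x; set M := maxwalk Z n x in M0 *.
have pm : (Num.max (Z y) 0 = Z y + Num.max (- Z y) 0)%R.
  by rewrite !maxEle; case: leP => h1; case: leP => h2; lra.
have m_ge0 : (0 <= Num.max (- Z y) 0)%R by rewrite le_max lexx orbT.
rewrite pm -lerBrDr ge_max.
have [h|h] := ltP M m0.
  have -> : (\1_[set x | (maxwalk Z n x < m0)%R] x = 1 :> R)%R by rewrite indicE mem_set.
  by apply/andP; split; lra.
have -> : (\1_[set x | (maxwalk Z n x < m0)%R] x = 0 :> R)%R.
  by rewrite indicE memNset//=; apply/negP; rewrite -leNgt.
by apply/andP; split; lra.
Qed.

Lemma ge0_integral_prodM (f : Y -> \bar R) (g : seqspace Y -> \bar R) :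
  measurable_fun setT f -> measurable_fun setT g ->
  (forall y, 0 <= f y) -> (forall x, 0 <= g x) ->
  \int[(Q \x Lam)%E]_z (f z.1 * g z.2) = (\int[Q]_y f y) * (\int[Lam]_x g x).
Proof.
move=> mf mg f0 g0; rewrite fubini_tonelli1.
- rewrite /fubini_F /=; under eq_integral do rewrite ge0_integralZl//.
  by rewrite ge0_integralZr// integral_ge0.
- apply: emeasurable_funM; first exact: (measurableT_comp mf measurable_fst).
  exact: (measurableT_comp mg measurable_snd).
- by move=> z; rewrite mule_ge0.
Qed.

Lemma ge0_integral_sconsE (F : seqspace Y -> \bar R) :
  measurable_fun setT F -> (forall x, 0 <= F x) ->
  \int[Lam]_x F x = \int[(Q \x Lam)%E]_z F (scons z).
Proof.
move=> mF F0; rewrite (ge0_integral_scons Lam_cylinder)// fubini_tonelli1//.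
exact: (measurableT_comp mF (@measurable_scons _ Y)).
Qed.

Section bounded_below.
Variables (Z : Y -> R) (m0 : R).
Hypothesis mZ : measurable_fun setT Z.
Hypothesis m00 : (0 <= m0)%R.
Hypothesis Zm0 : forall y, (- m0 <= Z y)%R.

Let A := unbounded_walk Z.
Let mA : measurable A := measurable_unbounded_walk mZ.
Let lowset n := [set x | (maxwalk Z n x < m0)%R].
Let Zp := \int[Q]_y (Num.max (Z y) 0)%:E.
Let Zm := \int[Q]_y (Num.max (- Z y) 0)%:E.

Let mlow n : measurable (lowset n).
Proof.
rewrite -[X in measurable X]setTI (_ : lowset n = maxwalk Z n @^-1` `]-oo, m0[).
  exact: measurable_maxwalk.
by apply/seteqP; split => x /=; rewrite in_itv.
Qed.

Let mM n : measurable_fun setT (fun x => maxwalk Z n x).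
Proof. exact: measurable_maxwalk. Qed.

Let mZp : measurable_fun setT (fun y => Num.max (Z y) 0%R).
Proof. exact: measurable_maxr. Qed.

Let mZm : measurable_fun setT (fun y => Num.max (- Z y)%R 0%R).
Proof. by apply: measurable_maxr => //; exact: measurableT_comp. Qed.

Let Zp0 y : 0 <= (Num.max (Z y) 0)%:E.
Proof. by rewrite lee_fin le_max lexx orbT. Qed.

Let Zm_0 y : 0 <= (Num.max (- Z y) 0)%:E.
Proof. by rewrite lee_fin le_max lexx orbT. Qed.

Let M0 n x : 0 <= (maxwalk Z n x)%:E.
Proof. by rewrite lee_fin maxwalk_ge0. Qed.

Let e n := \int[Lam]_x (\1_A x * maxwalk Z n x)%:E.

Let mI (B : set (seqspace Y)) : measurable B -> measurable_fun setT (fun x => \1_B x : R).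
Proof. exact: measurable_indic. Qed.

Let msnd (f : seqspace Y -> R) : measurable_fun setT f ->
  measurable_fun setT (fun z : Y * seqspace Y => f z.2).
Proof. by move=> mf; exact: (measurableT_comp mf measurable_snd). Qed.

Let mfst (f : Y -> R) : measurable_fun setT f ->
  measurable_fun setT (fun z : Y * seqspace Y => f z.1).
Proof. by move=> mf; exact: (measurableT_comp mf measurable_fst). Qed.

Let mscons (f : seqspace Y -> R) : measurable_fun setT f ->
  measurable_fun setT (fun z : Y * seqspace Y => f (scons z)).
Proof. by move=> mf; exact: (measurableT_comp mf (@measurable_scons _ Y)). Qed.

(* Restricting to the event A makes the last term vanish as n goes to infinity. *)
Lemma maxwalk_drift n :
  e n.+1 + Zm * Lam A <= e n + Zp * Lam A + m0%:E * Lam (A `&` lowset n).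
Proof.
have LamI B : measurable B -> \int[Lam]_x (\1_B x)%:E = Lam B.
  by move=> mB; rewrite integral_indic// setIT.
have mAl : measurable (A `&` lowset n) by apply: measurableI.
have I0 B (x : seqspace Y) : (0 <= \1_B x :> R)%R by [].
(* Both sides become integrals over the first observation and the remaining sequence, so that the
   pointwise bound [maxwalk_scons_le] can be integrated. *)
have e1 : e n.+1 + Zm * Lam A = \int[(Q \x Lam)%E]_z
    (\1_A (scons z) * maxwalk Z n.+1 (scons z) + Num.max (- Z z.1) 0 * \1_A z.2)%:E.
  under [RHS]eq_integral do rewrite EFinD.
  rewrite ge0_integralD//; first 1 last.
  - by move=> z _; rewrite lee_fin mulr_ge0// maxwalk_ge0.
  - apply/measurable_EFinP; apply: measurable_funM; first exact: (mscons (mI mA)).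
    exact: (mscons (mM n.+1)).
  - by move=> z _; rewrite EFinM mule_ge0.
  - by apply/measurable_EFinP; apply: measurable_funM;
    [exact: (mfst mZm)|exact: (msnd (mI mA))].
  congr (_ + _).
    rewrite /e ge0_integral_sconsE//.
    + by apply/measurable_EFinP; apply: measurable_funM; [exact: mI|exact: mM].
    + by move=> x; rewrite lee_fin mulr_ge0// maxwalk_ge0.
  under [RHS]eq_integral do rewrite EFinM.
  rewrite (@ge0_integral_prodM (fun y => (Num.max (- Z y) 0)%:E) (fun x => (\1_A x)%:E)) ?LamI//.
  + exact/measurable_EFinP.
  + by apply/measurable_EFinP; exact: mI.
have e2 : e n + Zp * Lam A + m0%:E * Lam (A `&` lowset n) = \int[(Q \x Lam)%E]_z
    ((1 * (\1_A z.2 * maxwalk Z n z.2) + Num.max (Z z.1) 0 * \1_A z.2) + m0 * \1_(A `&` lowset n) z.2)%:E.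
  under [RHS]eq_integral do rewrite 2!EFinD.
  have P1 z : 0 <= (1 * (\1_A z.2 * maxwalk Z n z.2))%:E + (Num.max (Z z.1) 0 * \1_A z.2)%:E.
    by rewrite adde_ge0// lee_fin ?mulr_ge0// ?maxwalk_ge0// -lee_fin.
  have P2 z : 0 <= (1 * (\1_A z.2 * maxwalk Z n z.2))%:E.
    by rewrite lee_fin ?mulr_ge0// ?maxwalk_ge0.
  have P3 z : 0 <= (Num.max (Z z.1) 0 * \1_A z.2)%:E.
    by rewrite EFinM mule_ge0.
  have P4 z : 0 <= (m0 * \1_(A `&` lowset n) z.2)%:E by rewrite lee_fin mulr_ge0.
  have M2 : measurable_fun setT (fun z : Y * seqspace Y => (1 * (\1_A z.2 * maxwalk Z n z.2))%:E).
    apply/measurable_EFinP; apply: measurable_funM => //; apply: measurable_funM;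
      first exact: (msnd (mI mA)).
    exact: (msnd (mM n)).
  have M3 : measurable_fun setT (fun z : Y * seqspace Y => (Num.max (Z z.1) 0 * \1_A z.2)%:E).
    by apply/measurable_EFinP; apply: measurable_funM;
      [exact: (mfst mZp)|exact: (msnd (mI mA))].
  have M4 : measurable_fun setT (fun z : Y * seqspace Y => (m0 * \1_(A `&` lowset n) z.2)%:E).
    by apply/measurable_EFinP; apply: measurable_funM => //; exact: (msnd (mI mAl)).
  rewrite ge0_integralD//; last exact: emeasurable_funD.
  rewrite ge0_integralD//; congr (_ + _ + _).
  - under [RHS]eq_integral do rewrite EFinM.
    rewrite (@ge0_integral_prodM (fun y => 1) (fun x => (\1_A x * maxwalk Z n x)%:E))//.
    + by rewrite integral_probability_cst mul1e.
    + by apply/measurable_EFinP; apply: measurable_funM; [exact: mI|exact: mM].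
    + by move=> x; rewrite lee_fin mulr_ge0// maxwalk_ge0.
  - under [RHS]eq_integral do rewrite EFinM.
    rewrite (@ge0_integral_prodM (fun y => (Num.max (Z y) 0)%:E) (fun x => (\1_A x)%:E)) ?LamI//.
    + exact/measurable_EFinP.
    + by apply/measurable_EFinP; exact: mI.
  - under [RHS]eq_integral do rewrite EFinM.
    rewrite (@ge0_integral_prodM (fun y => m0%:E) (fun x => (\1_(A `&` lowset n) x)%:E)) ?LamI//.
    + by rewrite integral_probability_cst.
    + by apply/measurable_EFinP; exact: mI.
rewrite e1 e2; apply: ge0_le_integral => //.
- move=> z _; rewrite lee_fin addr_ge0// mulr_ge0// ?maxwalk_ge0//.
  by rewrite -lee_fin.
- apply/measurable_EFinP; apply: measurable_funD; apply: measurable_funM.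
  + exact: (mscons (mI mA)).
  + exact: (mscons (mM n.+1)).
  + exact: (mfst mZm).
  + exact: (msnd (mI mA)).
- apply/measurable_EFinP; apply: measurable_funD; [apply: measurable_funD|].
  + apply: measurable_funM => //; apply: measurable_funM;
    [exact: (msnd (mI mA))|exact: (msnd (mM n))].
  + by apply: measurable_funM; [exact: (mfst mZp)|exact: (msnd (mI mA))].
  + by apply: measurable_funM => //; exact: (msnd (mI mAl)).
- move=> [y x] _; rewrite lee_fin [_.1]/= [_.2]/= mul1r.
  have [xA|xA] := pselect (A x); last first.
    have -> : (\1_A (scons (y, x)) = 0 :> R)%R.
      by rewrite indicE memNset// => /unbounded_walk_scons.
    have -> : (\1_A x = 0 :> R)%R by rewrite indicE memNset.
    by rewrite !mul0r !mulr0 !add0r mulr_ge0.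
  have -> : (\1_A x = 1 :> R)%R by rewrite indicE mem_set.
  have -> : (\1_(A `&` lowset n) x = \1_(lowset n) x :> R)%R.
    by rewrite indicI /= {1}indicE mem_set// mul1r.
  rewrite !mulr1 !mul1r; apply: le_trans (maxwalk_scons_le n x m00 (Zm0 y)).
  rewrite lerD2r -[X in (_ <= X)%R]mul1r ler_wpM2r ?maxwalk_ge0//.
Qed.

(** Since [e] is nondecreasing and finite, it cancels from [maxwalk_drift] and leaves
    [(Zm - Zp) * Lam A] bounded by [m0] times the mass of [A] intersected with [lowset n]. On [A]
    the maxima eventually exceed [m0], so this mass tends to 0. *)
Lemma bounded_below_walk_bounded : Zp < Zm -> Lam A = 0.
Proof.
move=> ZpZm.
have Zmfin : Zm \is a fin_num.
  rewrite ge0_fin_numE; last exact: integral_ge0.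
  apply: (@le_lt_trans _ _ (\int[Q]_y m0%:E)).
    apply: ge0_le_integral => //; first exact/measurable_EFinP.
    by move=> y _; rewrite lee_fin ge_max m00 lerNl Zm0.
  by rewrite integral_probability_cst ltry.
have Zpfin : Zp \is a fin_num.
  by rewrite ge0_fin_numE; [apply: (lt_trans ZpZm);
    rewrite ltey_eq Zmfin|exact: integral_ge0].
have LamAfin B : measurable B -> Lam B \is a fin_num by exact: fin_num_measure.
have mAl n : measurable (A `&` lowset n) by apply: measurableI.
(* Finiteness propagates from [n] to [n.+1] by [maxwalk_drift] itself. *)
have efin n : e n \is a fin_num.
  elim: n => [|n IHn].
    by rewrite /e; under eq_integral do rewrite /= mulr0; rewrite integral0.
  rewrite ge0_fin_numE; last by apply: integral_ge0 => x _;
    rewrite lee_fin mulr_ge0// maxwalk_ge0.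
  apply: (@le_lt_trans _ _ (e n.+1 + Zm * Lam A)).
    by rewrite leeDl// mule_ge0// integral_ge0.
  apply: (le_lt_trans (maxwalk_drift n)).
  apply: lte_add_pinfty; [apply: lte_add_pinfty|].
  - by rewrite ltey_eq; apply/orP; left.
  - by rewrite ltey_eq fin_numM// LamAfin.
  - by rewrite ltey_eq fin_numM// LamAfin.
have emono n : e n <= e n.+1.
  apply: ge0_le_integral => //.
  - by move=> x _; rewrite lee_fin mulr_ge0// maxwalk_ge0.
  - by apply/measurable_EFinP; apply: measurable_funM; [exact: mI|exact: mM].
  - by apply/measurable_EFinP; apply: measurable_funM; [exact: mI|exact: mM].
  - by move=> x _; rewrite lee_fin ler_wpM2l// maxwalk_nd.
have key n : (Zm - Zp) * Lam A <= m0%:E * Lam (A `&` lowset n).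
  have := le_trans (leeD2r (Zm * Lam A) (emono n)) (maxwalk_drift n).
  rewrite -addeA leeD2lE// => h.
  by rewrite muleBl// ?LamAfin// ?fin_num_adde_defr// leeBlDl ?fin_numM ?LamAfin.
have cvg0 : m0%:E * Lam (A `&` lowset n) @[n --> \oo] --> 0.
  rewrite -[X in _ --> X](mule0 m0%:E); apply: cvgeZl => //.
  rewrite -(measure0 Lam).
  rewrite (_ : set0 = \bigcap_n (A `&` lowset n)); last first.
    apply/esym/seteqP; split => // x h.
    have [xA _] := h 0%N I.
    have [n _ /= hn] := xA (Num.truncn m0).+1 I.
    have [_ hl] := h n I.
    by have := lt_trans hn hl; rewrite ltNge (ltW (truncnS_gt _)).
  apply: nonincreasing_cvg_mu => //.
  - by apply: (@le_lt_trans _ _ 1); [exact: probability_le1|rewrite ltry].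
  - exact: bigcap_measurableType.
  - move=> m n mn; apply/subsetPset => x [xA /= h]; split => //=.
    by apply: le_lt_trans h; exact: maxwalk_homo.
have : (Zm - Zp) * Lam A <= 0.
  rewrite -(cvg_lim _ cvg0)//; apply: lime_ge; first by apply/cvg_ex; exists 0.
  exact: nearW.
have Zpos : 0 < Zm - Zp by rewrite sube_gt0.
by rewrite pmule_rle0// => h; apply/eqP; rewrite eq_le h measure_ge0.
Qed.

End bounded_below.

(** Truncating [Z] from below at a large level [- m] keeps the drift negative, by monotone
    convergence, and only increases the walk. Comparing positive and negative parts allows the
    negative part to have infinite mean. *)
Lemma walk_bounded (Z : Y -> R) : measurable_fun setT Z ->
  \int[Q]_y (Num.max (Z y) 0)%:E < \int[Q]_y (Num.max (- Z y) 0)%:E ->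
  {ae Lam, forall x : seqspace Y, exists M : R, forall n, (\sum_(i < n) Z (x i) <= M)%R}.
Proof.
move=> mZ ZpZm.
have mn : measurable_fun setT (fun y => Num.max (- Z y)%R 0%R).
  by apply: measurable_maxr => //; exact: measurableT_comp.
pose g n y := (Num.min (Num.max (- Z y) 0) n%:R)%:E.
have cvgg : \int[Q]_y g n y @[n --> \oo] --> \int[Q]_y (Num.max (- Z y) 0)%:E.
  rewrite (_ : \int[Q]_y (Num.max (- Z y) 0)%:E = \int[Q]_y limn (g^~ y));
    last first.
    apply: eq_integral => y _; apply/esym/cvg_lim => //.
    apply: cvg_near_cst; exists (Num.truncn (Num.max (- Z y) 0)%R).+1 => // n /= hn.
    rewrite /g min_l// (le_trans (ltW (truncnS_gt _)))// ler_nat//.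
  apply: cvg_monotone_convergence => //.
  - by move=> n; apply/measurable_EFinP; apply: measurable_minr.
  - by move=> n y _; rewrite lee_fin le_min le_max lexx orbT/=.
  - by move=> y _ m n mn'; rewrite lee_fin le_min ge_min lexx/= ge_min ler_nat mn' orbT.
have [m hm] : exists m, \int[Q]_y (Num.max (Z y) 0)%:E < \int[Q]_y g m y.
  apply: contrapT => /forallNP h; move: ZpZm; rewrite ltNge => /negP; apply.
  rewrite -(cvg_lim _ cvgg)//; apply: lime_le; first by apply/cvg_ex; eexists;
    exact: cvgg.
  by apply: nearW => n; rewrite leNgt; apply/negP; exact: h.
pose Z' y := Num.max (Z y) (- m%:R)%R.
have mZ' : measurable_fun setT Z' by apply: measurable_maxr.
have m00 : (0 <= m%:R :> R)%R by [].
have Z'm y : (- m%:R <= Z' y)%R by rewrite le_max lexx orbT.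
have : Lam (unbounded_walk Z') = 0.
  apply: (bounded_below_walk_bounded mZ' m00 Z'm).
  rewrite (_ : (fun y => (Num.max (Z' y) 0)%:E) = (fun y => (Num.max (Z y) 0)%:E));
    last first.
    apply/funext => y; congr EFin; rewrite /Z' -maxA; congr Num.max.
    by apply/max_idPr; rewrite oppr_le0.
  rewrite (_ : (fun y => (Num.max (- Z' y) 0)%:E) = g m)//.
  apply/funext => y; congr EFin; rewrite /Z' oppr_max opprK max_minl; congr Num.min.
  exact/max_idPl.
move=> L0; exists (unbounded_walk Z'); split => //;
  first exact: measurable_unbounded_walk.
move=> x /= hx; apply: contrapT => nx; apply: hx.
have : exists m, forall n, (maxwalk Z' n x <= m%:R)%R.
  apply: contrapT => h; apply: nx => k _; apply: contrapT => h'; apply: h;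
    exists k => n.
  by rewrite leNgt; apply/negP => h''; apply: h'; exists n.
move=> [k hk]; exists k%:R => n; apply: le_trans (hk n).
apply: le_trans (walk_le_maxwalk Z' n x); apply: ler_sum => i _.
by rewrite le_max lexx.
Qed.

End random_walk.

(** * Kullback-Leibler divergence and the denominator *)

Lemma measurable_invr (R : realType) : measurable_fun setT (fun x : R => x^-1)%R.
Proof.
rewrite (_ : (fun x => _) = (fun x : R => x * (x ^+ 2) `^ (-1))%R).
  have m2 : measurable_fun setT (fun x : R => (x ^+ 2) `^ (-1))%R.
    exact: (measurableT_comp (@measurable_powR R (-1)%R) (@exprn_measurable R setT 2)).
  exact: measurable_funM.
apply/funext => x; rewrite powR_inv1 ?sqr_ge0//.
by have [->|x0] := eqVneq x 0%R; [rewrite invr0 mul0r|field].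
Qed.

Lemma measurable_fun_div d (T : measurableType d) (R : realType) (f g : T -> R) :
  measurable_fun setT f -> measurable_fun setT g -> measurable_fun setT (fun x => f x / g x)%R.
Proof.
by move=> mf mg; apply: measurable_funM => //;
  exact: (measurableT_comp (@measurable_invr R)).
Qed.

Section kullback_leibler.
Context d (Y : measurableType d) (R : realType).
Variables (mu : {sigma_finite_measure set Y -> \bar R}) (f0 : Y -> R).
Hypothesis f0_density : is_density mu f0.

Let mf0 : measurable_fun setT f0. Proof. by case: f0_density. Qed.

Let f0_ge0 y : (0 <= f0 y)%R. Proof. by case: f0_density. Qed.

Definition KL_integrand (f : Y -> R) y : \bar R :=
  lne (density_ratio f0 f y) * (f0 y)%:E.

Lemma KL_integrandE f y : (0 <= f y)%R -> KL_integrand f y =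
  if f0 y == 0%R then 0 else if f y == 0%R then +oo
  else (ln (f0 y / f y) * f0 y)%:E.
Proof.
move=> f_ge0; rewrite /KL_integrand /density_ratio.
have [f00|f00] := eqVneq (f0 y) 0%R; first by rewrite f00 mule0.
have f0p : (0 < f0 y)%R by rewrite lt0r f00 f0_ge0.
rewrite inver; have [_|fn0] := eqVneq (f y) 0%R.
  by rewrite gt0_muley ?lte_fin//= gt0_mulye ?lte_fin.
have fp : (0 < f y)%R by rewrite lt0r fn0.
by rewrite -EFinM lne_EFin ?divr_gt0// -EFinM.
Qed.

(** From ln (f / f0) <= f / f0. The negative part of the integrand is thus dominated by a
    density. *)
Lemma KL_integrand_ge f y : (0 <= f y)%R -> (- f y)%:E <= KL_integrand f y.
Proof.
move=> f_ge0; rewrite KL_integrandE//; case: eqP => [_|/eqP f00].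
  by rewrite lee_fin oppr_le0.
have f0p : (0 < f0 y)%R by rewrite lt0r f00 f0_ge0.
case: eqP => [_|/eqP fn0]; first exact: leey.
have fp : (0 < f y)%R by rewrite lt0r fn0.
rewrite lee_fin -[(f0 y / f y)%R]invrK invf_div lnV ?posrE ?divr_gt0// mulNr lerN2.
by rewrite -ler_pdivlMr// ltW// ln_sublinear// divr_gt0.
Qed.

Lemma measurable_KL_integrand_gen d' (S : measurableType d') (u v : S -> R) :
  measurable_fun setT u -> measurable_fun setT v ->
  measurable_fun setT (fun s => if u s == 0%R then 0 else if v s == 0%R then +oo
    else (ln (u s / v s) * u s)%:E).
Proof.
move=> mmu mv; apply: measurable_fun_if => //; first exact: measurable_fun_eqr.
apply: measurable_fun_if => //.
- rewrite setTI; rewrite (_ : _ @^-1` _ = ~` (u @^-1` [set 0%R])).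
    by apply: measurableC; rewrite -[X in measurable X]setTI; exact: mmu.
  by apply/seteqP; split => s /=; [move=> h /eqP; rewrite h|move/eqP/negbTE].
- by apply: measurable_funTS; exact: measurable_fun_eqr.
- apply: measurable_funTS; apply/measurable_EFinP; apply: measurable_funM => //.
  apply: (measurableT_comp (@measurable_ln R)).
  exact: measurable_fun_div.
Qed.

Lemma measurable_KL_integrand f : is_density mu f -> measurable_fun setT (KL_integrand f).
Proof.
move=> [mf f_ge0 _].
rewrite (_ : KL_integrand f = fun y => if f0 y == 0%R then 0 else if f y == 0%R then +oo
  else (ln (f0 y / f y) * f0 y)%:E).
  exact: measurable_KL_integrand_gen.
by apply/funext => y; exact: KL_integrandE.
Qed.

(** The negative part has integral at most 1, so a divergence below [+oo] forces the positive part
    to be integrable too. *)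
Lemma KL_integrable f : is_density mu f -> KL mu f0 f < +oo ->
  mu.-integrable setT (KL_integrand f).
Proof.
move=> fd KLoo; have mg := measurable_KL_integrand fd; have [mf f_ge0 f1] := fd.
have neg : \int[mu]_y (KL_integrand f)^\- y < +oo.
  apply: (@le_lt_trans _ _ (\int[mu]_y (f y)%:E)); last by rewrite f1 ltry.
  apply: ge0_le_integral => //; first exact: measurable_funeneg.
    exact/measurable_EFinP.
  move=> y _; rewrite funenegE ge_max lee_fin f_ge0 andbT.
  by rewrite leeNl -EFinN KL_integrand_ge.
have pos : \int[mu]_y (KL_integrand f)^\+ y < +oo.
  rewrite ltNge leye_eq; apply/negP => /eqP pos; move: KLoo.
  rewrite /KL -/(KL_integrand f) (_ : \int[mu]_y _ = \int[mu]_y KL_integrand f y)//.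
  rewrite integralE pos addye ?ltxx// eqe_oppLR.
  by rewrite lt_eqF.
apply/integrableP; split => //.
rewrite (_ : (fun y => `|KL_integrand f y|) = (KL_integrand f)^\+ \+ (KL_integrand f)^\-); last first.
  exact: fune_abse.
rewrite ge0_integralD//.
- exact: lte_add_pinfty.
- exact: measurable_funepos.
- exact: measurable_funeneg.
Qed.

(** An integrable function is finite almost everywhere, and the integrand is [+oo] where
    [f = 0 < f0]. *)
Lemma KL_pos_ae f : is_density mu f -> KL mu f0 f < +oo ->
  {ae mu, forall y, f0 y != 0%R -> (0 < f y)%R}.
Proof.
move=> fd KLoo; have [mf f_ge0 f1] := fd.
have := integrable_ae measurableT (KL_integrable fd KLoo).
apply: filterS => y /(_ I); rewrite KL_integrandE// => + f00.
by rewrite (negbTE f00) lt0r f_ge0; case: eqP.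
Qed.

Lemma measurable_KL dT (T : measurableType dT) (p : T -> Y -> R) : density_family mu p ->
  measurable_fun setT (fun t => KL mu f0 (p t)).
Proof.
move=> pf; have p_ge0 t y : (0 <= p t y)%R by have [] := family_density pf t.
have mg : measurable_fun setT (fun z : T * Y => KL_integrand (p z.1) z.2).
  rewrite (_ : (fun z => _) = fun z : T * Y => if f0 z.2 == 0%R then 0 else
      if p z.1 z.2 == 0%R then +oo else (ln (f0 z.2 / p z.1 z.2) * f0 z.2)%:E).
    apply: measurable_KL_integrand_gen; first exact: (measurableT_comp mf0 measurable_snd).
    exact: (family_measurable pf).
  by apply/funext => z; exact: KL_integrandE.
rewrite (_ : (fun t => _) = (fun t => \int[mu]_y (KL_integrand (p t))^\+ y) \-
   (fun t => \int[mu]_y (KL_integrand (p t))^\- y)); last first.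
  by apply/funext => t; rewrite /KL -integralE.
apply: emeasurable_funB.
- rewrite (_ : (fun t => _) = fubini_F mu (fun z : T * Y => KL_integrand (p z.1) z.2)^\+); last first.
    by apply/funext => t; apply: eq_integral => y _; rewrite !funeposE.
  apply: measurable_fun_fubini_tonelli_F => //.
  exact: measurable_funepos.
- rewrite (_ : (fun t => _) = fubini_F mu (fun z : T * Y => KL_integrand (p z.1) z.2)^\-); last first.
    by apply/funext => t; apply: eq_integral => y _; rewrite !funenegE.
  apply: measurable_fun_fubini_tonelli_F => //.
  exact: measurable_funeneg.
Qed.

Variable Q : probability Y R.
Hypothesis QE : forall B, measurable B -> Q B = \int[mu]_(y in B) (f0 y)%:E.

Lemma ae_density (P : Y -> Prop) : {ae mu, forall y, f0 y != 0%R -> P y} -> {ae Q, forall y, P y}.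
Proof.
move=> [N [mN N0 hN]]; exists (N `|` f0 @^-1` [set 0%R]); split.
- by apply: measurableU => //; rewrite -[X in measurable X]setTI; exact: mf0.
- apply/eqP; rewrite eq_le measure_ge0 andbT.
  have mZ : measurable (f0 @^-1` [set 0%R]) by rewrite -[X in measurable X]setTI;
    exact: mf0.
  apply: (@le_trans _ _ (Q N + Q (f0 @^-1` [set 0%R]))); first exact: measureU2.
  rewrite !QE// (null_set_integral mN)//;
    last exact/measurable_EFinP/measurable_funTS.
  rewrite add0e (@eq_integral _ _ _ _ _ (cst 0)) ?integral0//.
  by move=> y /set_mem /= ->.
- move=> y /= nP; have [f00|/eqP f00] := pselect (f0 y = 0%R); first by right.
  by left; apply: hN => /= h; apply: nP; exact: h.
Qed.

(** Almost everywhere [Z * f0] is the difference [H] of the two divergence integrands minus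
    [e * f0], as [ln f0] cancels. So [Z] has mean [KLstar mu f0 g f - e], which is negative. *)
Lemma log_ratio_drift (f g Z : Y -> R) (e : R) : is_density mu f -> is_density mu g ->
  KL mu f0 g \is a fin_num -> KLstar mu f0 g f < e%:E ->
  Z = (fun y => - ln (f y / g y) - e)%R ->
  \int[Q]_y (Num.max (Z y) 0)%:E < \int[Q]_y (Num.max (- Z y) 0)%:E.
Proof.
move=> fd gd gfin KLe ZE; have [mf f_ge0 f1] := fd; have [mg g_ge0 g1] := gd.
have goo : KL mu f0 g < +oo by rewrite ltey_eq gfin.
have foo : KL mu f0 f < +oo.
  rewrite ltNge leye_eq; apply/negP => /eqP foo.
  by move: KLe; rewrite /KLstar foo addye// ; move: gfin;
    rewrite -fin_numN fin_numE => /andP[].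
have intf := KL_integrable fd foo; have intg := KL_integrable gd goo.
have mZ : measurable_fun setT Z.
  rewrite ZE.
  apply: measurable_funB => //; apply: measurableT_comp => //.
  apply: (measurableT_comp (@measurable_ln R)).
  exact: measurable_fun_div.
pose G y := (Z y * f0 y)%:E.
pose H y := KL_integrand f y - KL_integrand g y - (e * f0 y)%:E.
have mG : measurable_fun setT G by apply/measurable_EFinP/measurable_funM.
have int0 : mu.-integrable setT (fun y => (e * f0 y)%:E).
  rewrite (_ : (fun y => _) = fun y => e%:E * (f0 y)%:E)//;
    apply: integrableZl => //.
  apply/integrableP; split; first exact/measurable_EFinP.
  under eq_integral do rewrite gee0_abs ?lee_fin//.
  by case: f0_density => _ _ ->; rewrite ltry.
have intfg : mu.-integrable setT (KL_integrand f \- KL_integrand g) by exact: integrableB.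
have intH : mu.-integrable setT H by exact: integrableB.
have HE : \int[mu]_y H y = KL mu f0 f - KL mu f0 g - e%:E.
  rewrite integralB// integralB//; congr (_ - _ - _).
  under eq_integral do rewrite EFinM.
  rewrite integralZl//; last first.
    apply/integrableP; split; first exact/measurable_EFinP.
    under eq_integral do rewrite gee0_abs ?lee_fin//.
    by case: f0_density => _ _ ->; rewrite ltry.
  by case: f0_density => _ _ ->; rewrite mule1.
have GH : {ae mu, forall y, G y = H y}.
  apply: filterS2 (KL_pos_ae fd foo) (KL_pos_ae gd goo) => y hf hg.
  rewrite /G /H !KL_integrandE//.
  have [f00|f00] := eqVneq (f0 y) 0%R; first by rewrite f00 !mulr0 sub0e oppe0 adde0.
  have fp := hf f00; have gp := hg f00.
  have f0p : (0 < f0 y)%R by rewrite lt0r f00 f0_ge0.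
  rewrite !gt_eqF// -!EFinB; congr EFin; rewrite ZE !ln_div ?posrE//; ring.
have maxM (z c : R) : (0 <= c)%R -> (Num.max z 0 * c = Num.max (z * c) 0)%R.
  by move=> c0; rewrite maxr_pMl// mul0r.
have intp : \int[Q]_y (Num.max (Z y) 0)%:E = \int[mu]_y H^\+ y.
  rewrite (ge0_integral_density (mu := mu) (f := f0))//.
  - apply: ae_eq_integral => //.
    + by apply: emeasurable_funM; apply/measurable_EFinP => //;
      exact: measurable_maxr.
    + by apply: measurable_funepos; exact: measurable_int intH.
    + apply: filterS GH => y GHy _; rewrite -EFinM maxM//.
      by rewrite EFin_max -/(G y) GHy funeposE.
  - by apply/measurable_EFinP; exact: measurable_maxr.
  - by move=> y; rewrite lee_fin le_max lexx orbT.
have intm : \int[Q]_y (Num.max (- Z y) 0)%:E = \int[mu]_y H^\- y.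
  have mNZ : measurable_fun setT (fun y => Num.max (- Z y)%R 0%R).
    by apply: measurable_maxr => //; exact: measurableT_comp.
  rewrite (ge0_integral_density (mu := mu) (f := f0))//.
  - apply: ae_eq_integral => //.
    + by apply: emeasurable_funM; apply/measurable_EFinP.
    + by apply: measurable_funeneg; exact: measurable_int intH.
    + apply: filterS GH => y GHy _; rewrite -EFinM maxM// mulNr.
      by rewrite EFin_max EFinN -/(G y) GHy funenegE.
  - exact/measurable_EFinP.
  - by move=> y; rewrite lee_fin le_max lexx orbT.
rewrite intp intm -sube_lt0.
  rewrite -integralE HE suber_lt0//.
by rewrite integrable_pos_fin_num.
Qed.

End kullback_leibler.

Section denominators.
Context dY dT (Y : measurableType dY) (T : measurableType dT) (R : realType).
Variables (Q : probability Y R) (Lam : probability (seqspace Y) R) (Pi : probability T R).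
Hypothesis Lam_cylinder : forall n B, (forall i, measurable (B i)) ->
  Lam (cylinder n B) = \prod_(i < n) Q (B i).
Variable q : T -> Y -> R.
Hypothesis q0 : forall t y, (0 <= q t y)%R.
Hypothesis mq : measurable_fun setT (fun z : T * Y => q z.1 z.2).

Lemma ae_coord (P : Y -> Prop) : {ae Q, forall y, P y} ->
  {ae Lam, forall x : seqspace Y, forall i, P (x i)}.
Proof.
move=> [N [mN N0 hN]]; apply: ae_foralln => i.
exists ((fun x : seqspace Y => x i) @^-1` N); split.
- by rewrite -[X in measurable X]setTI; exact: measurable_coord.
- rewrite (_ : _ @^-1` _ = cylinder i.+1 (fun j => if j == i then N else setT)).
    transitivity (\prod_(j < i.+1) Q (if (j : nat) == i then N else setT)).
      by apply: (Lam_cylinder _ (B := fun j => if j == i then N else setT)) => j;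
        case: ifP.
    by rewrite big_ord_recr/= eqxx N0 mule0.
  apply/seteqP; split => x /= h.
    by move=> j _; case: eqP => [->|].
  by have := h i (ltnSn _); rewrite eqxx.
- by move=> x /= nP; exact: hN.
Qed.

Lemma prod_expR_ge (q1 : Y -> R) (e M : R) (x : seqspace Y) : (forall i, 0 < q1 (x i))%R ->
  (forall n, \sum_(i < n) (- ln (q1 (x i)) - e) <= M)%R ->
  forall n, (expR (- M) <= expR (e * n%:R) * \prod_(i < n) q1 (x i))%R.
Proof.
move=> qp hM n.
have -> : (\prod_(i < n) q1 (x i) = expR (\sum_(i < n) ln (q1 (x i))))%R.
  by rewrite expR_sum; apply: eq_bigr => i _; rewrite lnK// posrE.
rewrite -expRD ler_expR lerNl; apply: le_trans (hM n).
rewrite sumrB sumrN sumr_const card_ord -mulr_natr; lra.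
Qed.

(** The constant of the lower bound depends on sequence and parameter; discretizing it as
    [k.+1%:R^-1] makes the good pairs a countable union of measurable sets. *)
Let low (e : R) k : set (seqspace Y * T) := \bigcap_(n in [set: nat])
  [set z : seqspace Y * T | k.+1%:R^-1 <= expR (e * n%:R) * \prod_(i < n) q z.2 (z.1 i)]%R.

Let mjoint n : measurable_fun setT (fun z : seqspace Y * T => \prod_(i < n) q z.2 (z.1 i))%R.
Proof.
have := @measurable_joint_likelihood _ _ Y T R q mq n (fun=> 1%R) (@measurable_cst _ _ _ _ _ _).
by congr (measurable_fun _ _); apply/funext => z; rewrite mul1r.
Qed.

Let mlow e k : measurable (low e k).
Proof.
apply: bigcap_measurableType => n _.
rewrite -[X in measurable X]setTI.
rewrite (_ : [set z | _] = (fun z : seqspace Y * T => expR (e * n%:R) * \prod_(i < n) q z.2 (z.1 i))%R @^-1` `[k.+1%:R^-1%R, +oo[).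
  by apply: measurable_funM => //; exact: mjoint.
by apply/seteqP; split => z /=; rewrite in_itv/= andbT.
Qed.

(** For each [t] in [B] almost every sequence is good; by Tonelli, for almost every sequence
    [Pi]-almost every [t] in [B] is good. The good [t] are a countable union over [k], so for one
    [k] they have positive mass, and integrating over these gives [kappa]. *)
Lemma mass_lower_bound (e : R) (B : set T) : measurable B -> 0 < Pi B ->
  (forall t, B t -> {ae Q, forall y, (0 < q t y)%R}) ->
  (forall t, B t -> {ae Lam, forall x : seqspace Y, exists M : R,
     forall n, (\sum_(i < n) (- ln (q t (x i)) - e) <= M)%R}) ->
  {ae Lam, forall x : seqspace Y, exists2 kappa : R, (0 < kappa)%R &
     forall n, (kappa * expR (- (e * n%:R)))%:E <= \int[Pi]_t (\prod_(i < n) q t (x i))%:E}.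
Proof.
move=> mB PiB qpos hM.
pose E := \bigcup_k low e k.
have mE : measurable E by exact: bigcup_measurable.
have aeE t : B t -> {ae Lam, forall x, E (x, t)}.
  move=> Bt; apply: filterS2 (ae_coord (qpos t Bt)) (hM t Bt) => x qx [M hMx].
  have := prod_expR_ge qx hMx.
  have eM : (0 < expR (- M))%R by rewrite expR_gt0.
  have /ltr_add_invr[k] := eM; rewrite add0r => hk h; exists k => // n _ /=.
  exact: le_trans (ltW hk) (h n).
pose f (z : seqspace Y * T) : \bar R := (\1_B z.2 * \1_(~` E) z)%:E.
have mf : measurable_fun setT f.
  apply/measurable_EFinP; apply: measurable_funM.
    by apply: (measurableT_comp _ measurable_snd); exact: measurable_indic.
  by apply: measurable_indic; exact: measurableC.
have f0 z : 0 <= f z by rewrite lee_fin mulr_ge0.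
have mF : measurable_fun setT (fun x => \int[Pi]_t f (x, t)).
  exact: (measurable_fun_fubini_tonelli_F f).
have F0 : \int[Lam]_x \int[Pi]_t f (x, t) = 0.
  rewrite fubini_tonelli//; transitivity (\int[Pi]_t (cst 0) t);
    last by rewrite integral0.
  apply: eq_integral => t _ /=.
  transitivity (\int[Lam]_x (cst 0) x); last by rewrite integral0.
  apply: ge0_ae_eq_integral => //; first exact: (measurable_fun_pair1 t mf).
  have [Bt|Bt] := pselect (B t).
    apply: filterS (aeE t Bt) => x Ext _ /=; rewrite /f /=.
    by rewrite [X in (_ * X)%R]indicE memNset ?mulr0//= => nE; exact: nE.
  by apply: aeW => x _; rewrite /f /= indicE memNset ?mul0r.
have aeF : {ae Lam, forall x, \int[Pi]_t f (x, t) = 0}.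
  have : \int[Lam]_x `|\int[Pi]_t f (x, t)| = 0.
    by rewrite -[RHS]F0; apply: eq_integral => x _; rewrite gee0_abs// integral_ge0.
  move/(ae_eq_integral_abs _ measurableT mF); apply: filterS => x; exact.
apply: filterS aeF => x Fx.
have mEx k : measurable (B `&` xsection (low e k) x).
  by apply: measurableI => //; exact: measurable_xsection.
have [k Ek] : exists k, 0 < Pi (B `&` xsection (low e k) x).
  apply: contrapT => /forallNP h.
  have z k : Pi (B `&` xsection (low e k) x) = 0.
    by apply/eqP; rewrite eq_le measure_ge0 andbT leNgt; apply/negP; exact: h.
  have BE0 : Pi (B `&` ~` xsection E x) = 0.
    have mBE : measurable (B `&` ~` xsection E x).
      by apply: measurableI => //; apply: measurableC; exact: measurable_xsection.
    rewrite -Fx -[LHS](_ : \int[Pi]_t (\1_(B `&` ~` xsection E x) t)%:E = _);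
      last first.
      by rewrite integral_indic// setIT.
    apply: eq_integral => t _; rewrite /f indicI /=; congr (_ * _)%:E.
    by rewrite !indicE !in_setC mem_xsection.
  have : Pi.-negligible B.
    apply: (@negligibleS _ _ _ _ ((B `&` ~` xsection E x) `|` \bigcup_k (B `&` xsection (low e k) x))).
      move=> t Bt; have [[j _ Ej]|nE] := pselect (E (x, t)).
        by right; exists j => //; split => //; rewrite /xsection /= mem_set.
      by left; split => //; rewrite /xsection/= => /set_mem.
    apply: negligibleU.
      apply/negligibleP => //.
      by apply: measurableI => //; apply: measurableC; exact: measurable_xsection.
    by apply: negligible_bigcup => j; apply/negligibleP; [exact: mEx|exact: z].
  by move/(measure_negligible mB) => PB0; move: PiB; rewrite PB0 ltxx.
set D := B `&` _ in Ek; have mD : measurable D := mEx k.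
have Dfin : Pi D \is a fin_num by exact: fin_num_measure.
exists (k.+1%:R^-1 * fine (Pi D))%R.
  by rewrite mulr_gt0// fine_gt0// Ek ltey_eq Dfin.
move=> n.
have mp : measurable_fun setT (fun t => (\prod_(i < n) q t (x i))%:E).
  by apply/measurable_EFinP; exact: (measurable_fun_pair2 x (mjoint n)).
apply: (@le_trans _ _ (\int[Pi]_(t in D) (\prod_(i < n) q t (x i))%:E)); last first.
  by apply: ge0_subset_integral => // t _; rewrite lee_fin prodr_ge0.
rewrite mulrAC EFinM fineK// -integral_cst//; apply: ge0_le_integral => //.
- by move=> t _; rewrite lee_fin mulr_ge0 ?expR_ge0.
- exact: measurable_funTS.
- move=> t [_ /set_mem h]; have /= hn := h n I.
  rewrite /= lee_fin expRN ler_pdivrMr ?expR_gt0// mulrC //.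
Qed.

End denominators.

(** * Borel-Cantelli bounds for the numerator *)

Section series.
Context {R : realType}.

Lemma nneseries_ge_term (h : nat -> \bar R) N j : (forall k, 0 <= h k) -> (N <= j)%N ->
  h j <= \sum_(N <= i <oo) h i.
Proof.
move=> h0 Nj; apply: le_trans (nneseries_lim_ge j.+1 _) => //.
by rewrite big_nat_recr //= leeDr// sume_ge0.
Qed.

Lemma geometric_nneseries_le (c r : R) : (0 <= c)%R -> (0 < r < 1)%R ->
  \sum_(n <oo) (c * r ^+ n)%:E <= (c / (1 - r))%:E.
Proof.
move=> c0 /andP[r0 r1]; have r1' : (0 < 1 - r)%R by rewrite subr_gt0.
apply: lime_le.
  by apply: is_cvg_nneseries => n _ _; rewrite lee_fin mulr_ge0// exprn_ge0// ltW.
apply: nearW => n; rewrite sumEFin lee_fin -mulr_sumr ler_wpM2l//.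
rewrite -[(1 - r)^-1%R]mul1r ler_pdivlMr//.
have -> : ((\sum_(0 <= i < n) r ^+ i) * (1 - r) = 1 - r ^+ n)%R.
  elim: n => [|n IHn]; first by rewrite big_geq// mul0r expr0 subrr.
  by rewrite big_nat_recr//= mulrDl IHn exprSr; ring.
by rewrite gerBl exprn_ge0// ltW.
Qed.

(** Borel-Cantelli in functional form: the sum of the [G n] is integrable, hence finite almost
    everywhere, and its tails tend to 0. *)
Lemma ae_eventually_lt1 d (S : measurableType d) (mu : {measure set S -> \bar R})
    (G : nat -> S -> \bar R) :
  (forall n, measurable_fun setT (G n)) -> (forall n x, 0 <= G n x) ->
  \sum_(n <oo) \int[mu]_x G n x < +oo ->
  {ae mu, forall x, exists n0, forall n, (n0 <= n)%N -> G n x < 1}.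
Proof.
move=> mG G0 Goo.
have mS : measurable_fun setT (fun x => \sum_(n <oo) G n x) by exact: ge0_emeasurable_sum.
have S0 x : 0 <= \sum_(n <oo) G n x by exact: nneseries_ge0.
have intS : mu.-integrable setT (fun x => \sum_(n <oo) G n x).
  apply/integrableP; split => //.
  under eq_integral do rewrite gee0_abs//.
  by rewrite integral_nneseries.
apply: filterS (integrable_ae measurableT intS) => x /(_ I) Sfin.
have Soo : \sum_(n <oo) G n x < +oo by rewrite ltey_eq Sfin.
have /(_ (fun n _ => G0 n x)) h := nneseries_tail_cvg Soo.
have /fine_cvgP[_ /cvgrPdist_lt/(_ _ ltr01)[n0 _ hn0]] := h.
have /fine_cvgP[[n1 _ hn1] _] := h.
exists (maxn n0 n1) => n; rewrite geq_max => /andP[h0 h1].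
apply: (@le_lt_trans _ _ (\sum_(n <= k <oo) G k x)); first exact: nneseries_ge_term.
have := hn0 n h0; have := hn1 n h1 => /= f1; rewrite sub0r normrN => f2.
rewrite -(fineK f1) lte_fin; apply: le_lt_trans f2; exact: ler_norm.
Qed.

End series.

Section numerators.
Context dY dT (Y : measurableType dY) (T : measurableType dT) (R : realType).
Variables (Q : probability Y R) (Lam : probability (seqspace Y) R) (Pi : probability T R).
Hypothesis Lam_cylinder : forall n B, (forall i, measurable (B i)) ->
  Lam (cylinder n B) = \prod_(i < n) Q (B i).
Variable q : T -> Y -> R.
Hypothesis q0 : forall t y, (0 <= q t y)%R.
Hypothesis mq : measurable_fun setT (fun z : T * Y => q z.1 z.2).

(** The point is that the bound does not depend on [a]. *)
Lemma rpow_le_max (x w a : R) : unitI a -> (0 <= x)%R -> (x <= w)%R ->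
  (1 <= w)%R -> (rpow x a <= w)%R.
Proof.
move=> a1 x0 xw w1; have /andP[a0 a1'] := a1;
  apply: le_trans (rpow_tangent x0 a1) _.
have [x1|x1] := leP x 1%R.
  apply: le_trans w1; rewrite gerDl mulr_ge0_le0// subr_le0//.
apply: le_trans xw; rewrite -lerBrDl -[X in (_ <= X)%R]mul1r ler_wpM2r// subr_ge0 ltW//.
Qed.

Lemma erpow_lt1 (x : \bar R) (a : R) : (0 <= a)%R -> 0 <= x -> erpow x a < 1 -> x <= 1.
Proof. by case: x => [r| |]//= a0 r0; rewrite lte_fin lee_fin; exact: rpow_lt1. Qed.

Lemma likelihood_cst (A : set T) n (w : R) x : measurable A -> (0 <= w)%R ->
  likelihood q Pi A n (fun=> w) x = w%:E * likelihood q Pi A n (fun=> 1%R) x.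
Proof.
move=> mA w0; rewrite /likelihood -ge0_integralZl_EFin//.
- by apply: eq_integral => t _; rewrite mul1r EFinM.
- by move=> t _; rewrite lee_fin mul1r prodr_ge0.
- apply/measurable_EFinP/measurable_funTS.
  have := measurable_fun_pair2 x (measurable_joint_likelihood mq n (@measurable_cst _ _ T R setT 1%R)).
  exact.
Qed.

Variables (A : nat -> nat -> set T) (N : nat) (r : R).
Hypothesis mA : forall j i, measurable (A j i).
Hypothesis cA : forall j i, mix_closed Q q (A j i).
Hypothesis r01 : (0 < r < 1)%R.
Hypothesis A_moment : forall j i t, A j i t ->
  exists2 a, unitI a & rmoment Q q t a < (r ^+ (2 * j.+1))%:E.

Let r0 : (0 < r)%R. Proof. by case/andP : r01. Qed.
Let r1 : (r < 1)%R. Proof. by case/andP : r01. Qed.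
Let rX0 n : (0 < r ^+ n)%R. Proof. exact: exprn_gt0. Qed.

(** Rescaled by [w n j], the inverse of the target bound, the likelihood satisfies the target as
    soon as its power [W n j i] is below 1, whatever the exponent. The moment bound contributes
    [r ^+ (2 * j.+1 * n)] and the rescaling at most [w n j], so [W n j i] has expectation at most
    [r ^+ (n * j.+1)]. *)
Lemma ae_likelihood_pieces : {ae Lam, forall x : seqspace Y, exists n0, forall n, (n0 <= n)%N ->
  forall j i, (i < N)%N -> likelihood q Pi (A j i) n (fun=> 1%R) x <= (r ^+ (n * j.+1))%:E}.
Proof.
have ex j i : {a | unitI a & forall t, A j i t -> rmoment Q q t a <= (r ^+ (2 * j.+1))%:E}.
  by apply: cid2; apply: uniform_exponent => //; exact: A_moment.
pose a j i := s2val (ex j i).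
have a1 j i : unitI (a j i) := s2valP (ex j i).
have a_moment j i := s2valP' (ex j i) : forall t, A j i t -> rmoment Q q t (a j i) <= _.
pose w n j := (r ^+ (n * j.+1))^-1%R.
have w0 n j : (0 <= w n j)%R by rewrite invr_ge0 ltW.
have w1 n j : (1 <= w n j)%R by rewrite -[X in (X <= _)%R]invr1 lef_pV2 ?posrE// exprn_ile1// ltW.
pose W n j i x := erpow (likelihood q Pi (A j i) n (fun=> w n j) x) (a j i).
have W0 n j i x : 0 <= W n j i x by exact: erpow_ge0.
have mW n j i : measurable_fun setT (W n j i).
  by apply: (measurableT_comp (measurable_erpow _)); exact: measurable_likelihood.
have intW n j i : \int[Lam]_x W n j i x <= (r ^+ (n * j.+1))%:E.
  have := likelihood_moment q0 mq Pi Lam_cylinder (mA j i) (@cA j i) (a1 j i) (rX0 _) (@a_moment j i)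
    n (k := fun=> w n j) (@measurable_cst _ _ _ _ _ _) (fun=> w0 n j).
  move/le_trans; apply.
  have /fineK Pfin : Pi (A j i) \is a fin_num by exact: fin_num_measure.
  have -> : \int[Pi]_(t in A j i) (w n j)%:E = (w n j * fine (Pi (A j i)))%:E.
    by rewrite integral_cst// EFinM; congr (_ * _); exact/esym/Pfin.
  rewrite /= -EFinM lee_fin.
  have P0 : (0 <= fine (Pi (A j i)))%R by exact: fine_ge0.
  have P1 : (fine (Pi (A j i)) <= 1)%R.
    by rewrite -lee_fin Pfin; exact: probability_le1.
  have h : (rpow (w n j * fine (Pi (A j i))) (a j i) <= w n j)%R.
    apply: rpow_le_max => //; first by rewrite mulr_ge0.
    by rewrite -[X in (_ <= X)%R]mulr1 ler_wpM2l.
  apply: (le_trans (ler_wpM2l _ h)); first by rewrite exprn_ge0// ltW.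
  rewrite -exprM (_ : 2 * j.+1 * n = n * j.+1 + n * j.+1)%N; last by ring.
  by rewrite exprD -mulrA /w mulfV ?mulr1// gt_eqF.
(* Summing over all pieces makes [n0] uniform in [j] and [i]. *)
pose G n x := \sum_(j <oo) \sum_(i < N) W n j i x.
have G0 n x : 0 <= G n x by apply: nneseries_ge0 => j _ _; exact: sume_ge0.
have mS n j : measurable_fun setT (fun x => \sum_(i < N) W n j i x) by exact: emeasurable_sum.
have mG n : measurable_fun setT (G n).
  by apply: ge0_emeasurable_sum => // j x _ _; exact: sume_ge0.
(* The index starts at 1: for 0 the bounds [r ^+ (0 * j.+1)] are all 1 and not summable in [j]. *)
have intG n : \int[Lam]_x G n.+1 x <= (N%:R * r / (1 - r) * r ^+ n)%:E.
  rewrite integral_nneseries//; last by move=> j x _; exact: sume_ge0.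
  apply: (@le_trans _ _ (\sum_(j <oo) (N%:R * r ^+ n.+1 * r ^+ j)%:E)).
    apply: lee_nneseries => j _; first by move=> _; apply: integral_ge0 => x _;
      exact: sume_ge0.
    rewrite ge0_integral_sum//.
    apply: (@le_trans _ _ (\sum_(i < N) (r ^+ n.+1 * r ^+ j)%:E)).
      apply: lee_sum => i _; apply: (le_trans (intW _ _ _)).
      (* The product [n.+1 * j.+1] is at least [n.+1 + j], which makes the double series
         geometric. *)
      rewrite lee_fin -exprD; apply: ler_wiXn2l; [exact: ltW|exact: ltW|].
      by rewrite mulSn addSnnS addnC leq_add2l leq_pmulr.
    by rewrite sumEFin sumr_const card_ord -[X in X%:E <= _]mulr_natl mulrA.
  apply: le_trans (geometric_nneseries_le _ r01) _.
    by rewrite mulr_ge0// ltW.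
  by rewrite lee_fin le_eqVlt; apply/orP; left; apply/eqP; rewrite exprS; ring.
have : {ae Lam, forall x, exists n0, forall n, (n0 <= n)%N -> G n.+1 x < 1}.
  apply: ae_eventually_lt1 => //.
  apply: (@le_lt_trans _ _ (\sum_(n <oo) (N%:R * r / (1 - r) * r ^+ n)%:E)).
    by apply: lee_nneseries => n _ // _; apply: integral_ge0 => x _.
  apply: le_lt_trans (geometric_nneseries_le _ r01) _; last exact: ltry.
  by rewrite divr_ge0 ?mulr_ge0 ?subr_ge0// ltW.
apply: filterS => x [n0 hn0]; exists n0.+1 => -[//|n];
  rewrite ltnS => /hn0 Gn j i iN.
have Wlt : W n.+1 j i x < 1.
  apply: le_lt_trans Gn; apply: (@le_trans _ _ (\sum_(i < N) W n.+1 j i x)).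
    by rewrite (bigD1 (Ordinal iN))//= leeDl// sume_ge0.
  apply: (@nneseries_ge_term _ (fun j => \sum_(i < N) W n.+1 j i x) 0) => // k.
  exact: sume_ge0.
have L0 : 0 <= likelihood q Pi (A j i) n.+1 (fun=> w n.+1 j) x.
  by apply: integral_ge0 => t _; rewrite lee_fin mulr_ge0// prodr_ge0.
have /andP[aj0 _] := a1 j i.
have := erpow_lt1 aj0 L0 Wlt.
by rewrite likelihood_cst// /w -lee_pdivlMl ?invr_gt0// invrK mule1.
Qed.

(** The bounds on the pieces are summed as a geometric series. A negligible remainder is allowed
    because the balls cover the annuli only within the family that carries the prior. *)
Lemma ae_likelihood_cover (S : set T) : measurable S ->
  Pi.-negligible (S `\` \bigcup_j \bigcup_(i in [set i | (i < N)%N]) A j i) ->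
  {ae Lam, forall x : seqspace Y, exists n0, forall n, (n0 <= n)%N ->
    likelihood q Pi S n (fun=> 1%R) x <= (N%:R / (1 - r) * r ^+ n)%:E}.
Proof.
move=> mS nS; apply: filterS ae_likelihood_pieces => x [n0 hn0];
  exists n0.+1 => -[//|n].
rewrite ltnS => /leqW/hn0 hL.
pose g t := (1 * \prod_(i < n.+1) q t (x i))%:E.
have g0 t : 0 <= g t by rewrite lee_fin mul1r prodr_ge0.
have mg : measurable_fun setT g.
  apply/measurable_EFinP.
  exact: (measurable_fun_pair2 x (measurable_joint_likelihood mq n.+1 (@measurable_cst _ _ T R setT 1%R))).
have mIg B : measurable B -> measurable_fun setT (fun t => (\1_B t)%:E * g t).
  by move=> mB; apply: emeasurable_funM => //; apply/measurable_EFinP;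
    exact: measurable_indic.
have Ig0 B t : 0 <= (\1_B t)%:E * g t by apply: mule_ge0 => //; rewrite lee_fin.
have mSum j : measurable_fun setT (fun t => \sum_(i < N) ((\1_(A j i) t)%:E * g t)).
  by apply: emeasurable_sum => i; exact: mIg.
have Sum0 j t : 0 <= \sum_(i < N) ((\1_(A j i) t)%:E * g t) by exact: sume_ge0.
rewrite /likelihood -/g integral_restrict_indic.
apply: (@le_trans _ _ (\int[Pi]_t \sum_(j <oo) \sum_(i < N) ((\1_(A j i) t)%:E * g t))).
  apply: ae_ge0_le_integral => //.
  - exact: mIg.
  - by move=> t _; exact: nneseries_ge0.
  - exact: ge0_emeasurable_sum.
  - move: nS => [M [mM M0 hM]]; exists M; split => // t /= ht; apply: hM.
    apply: contrapT => nt; apply: ht => _.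
    have [St|St] := pselect (S t); last first.
      by rewrite indicE memNset// mul0e; exact: nneseries_ge0.
    have [j _ [i iN Aji]] : (\bigcup_j \bigcup_(i in [set i | (i < N)%N]) A j i) t.
      by apply: contrapT => h; apply: nt.
    rewrite indicE mem_set// mul1e.
    apply: (@le_trans _ _ (\sum_(i < N) ((\1_(A j i) t)%:E * g t))).
      rewrite (bigD1 (Ordinal iN))//= indicE mem_set// mul1e leeDl// sume_ge0//.
    exact: (@nneseries_ge_term _ (fun j => \sum_(i < N) ((\1_(A j i) t)%:E * g t)) 0).
rewrite integral_nneseries//.
apply: (@le_trans _ _ (\sum_(j <oo) (N%:R * r ^+ n.+1 * r ^+ j)%:E)).
  apply: lee_nneseries => j _; first by move=> _; apply: integral_ge0 => t _.
  rewrite ge0_integral_sum//; last by move=> i; exact: mIg.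
  apply: (@le_trans _ _ (\sum_(i < N) (r ^+ n.+1 * r ^+ j)%:E)).
    apply: lee_sum => i _; rewrite -integral_restrict_indic;
      apply: (le_trans (hL j i _)) => //.
    rewrite lee_fin -exprD; apply: ler_wiXn2l; [exact: ltW|exact: ltW|].
    by rewrite mulSn addSnnS addnC leq_add2l leq_pmulr.
  by rewrite sumEFin sumr_const card_ord -[X in X%:E <= _]mulr_natl mulrA.
apply: le_trans (geometric_nneseries_le _ r01) _.
  by rewrite mulr_ge0// ltW.
by rewrite lee_fin mulrAC.
Qed.

End numerators.

(** * The model *)

Section sample_law.
Context dO dY (Omega : measurableType dO) (Y : measurableType dY) (R : realType).
Variables (P : probability Omega R) (X : nat -> {RV P >-> Y}).

Definition sample_path (w : Omega) : seqspace Y := fun i => X i w.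

Lemma measurable_sample_path : measurable_fun setT sample_path.
Proof. by apply: measurable_to_seqspace => i; exact: measurable_funPT. Qed.

HB.instance Definition _ := isMeasurableFun.Build _ _ _ _ _ measurable_sample_path.

Lemma sample_path_cylinder (mu : {measure set Y -> \bar R}) (f0 : Y -> R) :
  iid_density mu f0 X -> forall n B, (forall i, measurable (B i)) ->
  distribution P sample_path (cylinder n B) = \prod_(i < n) distribution P (X 0%N) (B i).
Proof.
move=> [indep idist] n B mB.
have -> : \prod_(i < n) distribution P (X 0%N) (B i) = \prod_(i <- index_iota 0 n) P (X i @^-1` B i).
  rewrite big_mkord; apply: eq_bigr => i _.
  by rewrite idist// -(idist i)//.
rewrite -indep ?iota_uniq//; congr (P _).
rewrite -bigcap_seq; apply/seteqP; split => w /= h i.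
  by rewrite /= mem_index_iota => /andP[_ ?]; exact: h.
by move=> im; apply: h; rewrite /= mem_index_iota.
Qed.

Lemma ae_sample_path (G : seqspace Y -> Prop) :
  {ae distribution P sample_path, forall x, G x} -> {ae P, forall w, G (sample_path w)}.
Proof.
move=> [N [mN N0 hN]]; exists (sample_path @^-1` N); split => //.
- by rewrite -[X in measurable X]setTI; exact: measurable_sample_path.
- by move=> w /= nG; exact: hN.
Qed.

End sample_law.

Section model.
Context dY dT (Y : measurableType dY) (T : measurableType dT) (R : realType).
Variables (mu : {sigma_finite_measure set Y -> \bar R}) (f0 : Y -> R) (p : T -> Y -> R) (tstar : T).
Hypothesis f0_density : is_density mu f0.
Hypothesis p_family : density_family mu p.
Hypothesis tstar_fin : KL mu f0 (p tstar) \is a fin_num.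
Variable Q : probability Y R.
Hypothesis QE : forall B, measurable B -> Q B = \int[mu]_(y in B) (f0 y)%:E.

(** Unlike [density_ratio], this is 0 where [p tstar] vanishes. The two agree almost surely under
    the true law: finiteness of the divergence at [tstar] makes [p tstar] positive there. *)
Definition pratio t y : R := (p t y / p tstar y)%R.

Lemma family_ge0 t y : (0 <= p t y)%R.
Proof. by have [] := family_density p_family t. Qed.

Lemma pratio_ge0 t y : (0 <= pratio t y)%R.
Proof. by rewrite divr_ge0 ?family_ge0. Qed.

Lemma measurable_pratio : measurable_fun setT (fun z : T * Y => pratio z.1 z.2).
Proof.
apply: measurable_fun_div; first exact: family_measurable p_family.
have [mt _ _] := family_density p_family tstar.
exact: (measurableT_comp mt measurable_snd).
Qed.

Lemma star_pos_ae : {ae mu, forall y, f0 y != 0%R -> (0 < p tstar y)%R}.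
Proof.
apply: (KL_pos_ae f0_density (family_density p_family tstar)).
by rewrite ltey_eq tstar_fin.
Qed.

Lemma density_ratioE t y : (0 < p tstar y)%R ->
  density_ratio (p t) (p tstar) y = (pratio t y)%:E.
Proof. by move=> h; rewrite /density_ratio inver gt_eqF// EFinM. Qed.

(** At [a = 0] the two sides may differ: [hstar] is 1 by convention, [rmoment] is the probability
    that the ratio is nonzero. *)
Lemma hstar_rmoment t (a : R) : a != 0%R ->
  hstar mu f0 (p tstar) (p t) a = rmoment Q pratio t a.
Proof.
move=> a0; rewrite /hstar (negbTE a0) /rmoment.
have [mf0 f0_ge0 _] := f0_density.
have mr := measurable_rpow_section measurable_pratio t a.
rewrite (ge0_integral_density (mu := mu) (nu := Q) (f := f0))//; last first.
  by move=> y; exact: rpow_section_ge0.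
have E : {ae mu, forall y, poweR (density_ratio (p t) (p tstar) y) a * (f0 y)%:E =
    (rpow (pratio t y) a)%:E * (f0 y)%:E}.
  apply: filterS star_pos_ae => y h; have [->|f00] := eqVneq (f0 y) 0%R;
    first by rewrite !mule0.
  by rewrite density_ratioE ?h// rpowE.
have mg : measurable_fun setT (fun y => (rpow (pratio t y) a)%:E * (f0 y)%:E).
  by apply: emeasurable_funM => //; exact/measurable_EFinP.
apply: ge0_ae_eq_integral => //.
- apply: emeasurable_funM; last exact/measurable_EFinP.
  have mt := measurable_section1 (family_measurable p_family).
  apply: (measurableT_comp (measurable_poweR a)).
  apply: emeasurable_funM; first exact/measurable_EFinP/mt.
  rewrite (_ : (fun y => _) = fun y => if p tstar y == 0%R then +oo else ((p tstar y)^-1)%:E); last first.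
    by apply/funext => y; rewrite inver.
  apply: measurable_fun_if => //; first by apply: measurable_fun_eqr => //;
    exact: mt.
  apply: measurable_funTS; apply/measurable_EFinP.
  exact: (measurableT_comp (@measurable_invr R) (mt tstar)).
- by move=> y _; rewrite mule_ge0 ?poweR_ge0 ?lee_fin.
- by move=> y _; rewrite mule_ge0 ?lee_fin ?rpow_ge0.
- by apply: filterS E => y h _.
Qed.

Lemma small_moment t (c : R) : (c <= 1)%R -> inf_hstar mu f0 (p tstar) (p t) < c%:E ->
  exists2 a, unitI a & rmoment Q pratio t a < c%:E.
Proof.
move=> c1 /ereal_inf_lt[_ /= [a + <-]] hc; rewrite in_itv/= => a1; exists a => //.
(* The value of [hstar] at exponent 0 is 1, which is not below [c]. *)
have a0 : a != 0%R.
  by apply/eqP => a0; move: hc; rewrite /hstar a0 eqxx lte_fin ltNge c1.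
by rewrite -hstar_rmoment.
Qed.

(** Mixing commutes with division by the fixed function [p tstar], and sets null for [mu] are null
    for [Q]. *)
Lemma mixture_convex_mix_closed A : measurable A -> mixture_convex mu p A -> mix_closed Q pratio A.
Proof.
move=> mA cA nu nuA; have [|t At tE] := cA nu.
  move=> B mB AB; apply/eqP; rewrite eq_le probability_le1//=.
  apply: (@le_trans _ _ (nu A)); first by rewrite nuA.
  by apply: le_measure => //; rewrite inE.
exists t => //; apply: (ae_density f0_density QE); apply: filterS tE => y tE _.
rewrite EFinM tE /mixture -ge0_integralZr//.
- apply/measurable_EFinP.
  exact: (measurable_fun_pair1 y (family_measurable p_family)).
- by move=> s _; rewrite lee_fin family_ge0.
- by rewrite lee_fin invr_ge0 family_ge0.
Qed.

End model.

Section covers.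
Context (T : Type) (R : realType) (d : T -> T -> R).

Lemma bounded_covering_number (S : nat -> set T) (r : nat -> R) (t0 : T) :
  ereal_sup [set covering_number d (r j) (S j) | j in [set j : nat | (1 <= j)%N]] < +oo ->
  exists N (c : nat -> nat -> T), forall j,
    S j.+1 `<=` \bigcup_(i in [set i | (i < N)%N]) dball d (c j i) (r j.+1).
Proof.
set s := ereal_sup _ => soo.
have [N hN] : exists N : nat, s < N%:R%:E.
  have [s0|s0] := ltP s 0; first by exists 0%N.
  have sfin : s \is a fin_num by rewrite ge0_fin_numE.
  exists (Num.truncn (fine s)).+1; rewrite -(fineK sfin) lte_fin; exact: truncnS_gt.
have ex j : exists c : nat -> T, S j.+1 `<=` \bigcup_(i in [set i | (i < N)%N]) dball d (c i) (r j.+1).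
  have : covering_number d (r j.+1) (S j.+1) < N%:R%:E.
    by apply: le_lt_trans hN; apply: ereal_sup_ubound; exists j.+1.
  move=> /ereal_inf_lt[_ /= [n [c hc] <-]]; rewrite lte_fin ltr_nat => nN.
  (* The [n] centres, with [n < N], are padded with [t0], so that one [N] serves all annuli. *)
  exists (fun i => if insub i is Some i' then c i' else t0) => t St.
  have [i _ hi] := hc t St; exists (i : nat) => /=;
    first exact: ltn_trans (ltn_ord i) nN.
  by rewrite valK.
have [c hc] := choice ex.
by exists N, c.
Qed.

End covers.

Lemma lee_div_bounds (R : realType) (L D : \bar R) (a b : R) :
  0 <= L -> L <= a%:E -> (0 < b)%R -> b%:E <= D -> L / D <= (a / b)%:E.
Proof.
move=> L0 La b0; case: D => [r| |] //.
  rewrite lee_fin => br; have r0 : (0 < r)%R by exact: lt_le_trans br.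
  rewrite inver gt_eqF// EFinM; apply: lee_pmul => //; rewrite lee_fin.
    by rewrite invr_ge0 ltW.
  by rewrite lef_pV2.
move=> _; rewrite /inve mule0 lee_fin divr_ge0 ?(ltW b0)//.
by rewrite -lee_fin (le_trans L0).
Qed.


Section metric_sets.
Context dT (T : measurableType dT) (R : realType) (d : T -> T -> R).
Hypothesis d_metric : is_metric d.
Hypothesis d_balls_measurable : forall c r, measurable (dball d c r).

(** The complement is a closed ball, a countable intersection of open balls. *)
Lemma measurable_ball_exterior c (r : R) : measurable [set t | (r < d t c)%R].
Proof.
rewrite (_ : [set t | _] = ~` \bigcap_n dball d c (r + n.+1%:R^-1)%R).
  by apply: measurableC; exact: bigcap_measurableType.
apply/seteqP; split => t /=.
  move=> h hn; have := h; rewrite -subr_gt0 => /ltr_add_invr[k];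
    rewrite add0r => hk.
  by have := hn k I; rewrite /dball /= ltNge => /negP; apply; rewrite -lerBrDl ltW.
move=> hn; rewrite ltNge; apply/negP => h; apply: hn => n _.
by rewrite /dball /= (le_lt_trans h)// ltrDl.
Qed.

(** Two points of the ball are less than [2 * r] apart. This is the reason for radius one third of
    the distance to [u]. *)
Lemma far_ball c s t u (r : R) : (r <= d s u / 3%:R)%R ->
  dball d c r s -> dball d c r t -> (d s u / 3%:R <= d t u)%R.
Proof.
rewrite /dball /= => hr hs ht.
have := Defs.metric_triangle d_metric s c u;
  have := Defs.metric_triangle d_metric c t u.
by rewrite (Defs.metric_sym d_metric c t); lra.
Qed.

Lemma annulus (x eps : R) : (0 < eps)%R -> (eps < x)%R ->
  exists j, (j.+1%:R * eps <= x < j.+2%:R * eps)%R.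
Proof.
move=> e0 ex; have x0 : (0 <= x / eps)%R by rewrite divr_ge0 ?ltW// (lt_trans e0).
have /andP[h1 h2] := truncn_itv x0.
case: (Num.truncn (x / eps)) h1 h2 => [|j] h1 h2.
  by move: h2; rewrite ltr_pdivrMr// mul1r ltNge ltW.
by exists j; rewrite -ler_pdivlMr// -ltr_pdivrMr// h1.
Qed.

End metric_sets.

Theorem theorem4 (R : realType) (dY dT dO : measure_display)
    (Y : measurableType dY) (mu : {sigma_finite_measure set Y -> \bar R})
    (* the true density *)
    (f0 : Y -> R) (f0_density : is_density mu f0)
    (* T is the convex hull of F0 *)
    (T : measurableType dT) (p : T -> Y -> R) (p_family : density_family mu p)
    (F0 : set T) (hull_F0 : is_convex_hull mu p F0)
    (* the prior on F0 *)
    (Pi : probability T R) (Pi_F0 : carried_by Pi F0)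
    (* the Kullback-Leibler minimizer in F0 *)
    (tstar : T) (tstar_F0 : F0 tstar)
    (tstar_min : KL mu f0 (p tstar) = ereal_inf [set KL mu f0 (p t) | t in F0])
    (tstar_fin : KL mu f0 (p tstar) \is a fin_num)
    (tstar_uniq : forall t, F0 t ->
       KL mu f0 (p t) = ereal_inf [set KL mu f0 (p s) | s in F0] -> t = tstar)
    (* standing integrability assumptions *)
    (int_ratio : forall t, F0 t ->
       \int[mu]_y (density_ratio (p t) (p tstar) y * (f0 y)%:E) < +oo)
    (int_ratio0 : \int[mu]_y density_ratio f0 (p tstar) y < +oo)
    (* the observations *)
    (Omega : measurableType dO) (P : probability Omega R)
    (X : nat -> {RV P >-> Y}) (X_iid : iid_density mu f0 X)
    (* the metric *)
    (d : T -> T -> R) (d_metric : is_metric d)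
    (d_balls_measurable : forall c r, measurable (dball d c r))
    (d_balls_convex : forall c r, mixture_convex mu p (dball d c r))
    (* condition (1) *)
    (prior_pos : forall e : R, (0 < e)%R ->
       0 < Pi [set t | KLstar mu f0 (p tstar) (p t) < e%:E])
    (* condition (2) *)
    (h_d : forall e : R, (0 < e)%R ->
       [set t | (expR (- e ^+ 2))%:E < inf_hstar mu f0 (p tstar) (p t)]
         `<=` [set t | (d t tstar < e)%R])
    (eps : R) (eps_gt0 : (0 < eps)%R)
    (N_bounded :
       ereal_sup [set covering_number d (j%:R * eps / 3%:R)%R
                        [set t | F0 t /\
                           (j%:R * eps <= d t tstar < j.+1%:R * eps)%R]
                 | j in [set j : nat | (1 <= j)%N]] < +oo) :
  {ae P, forall w,
     posterior p Pi (p tstar) X n w [set t | (eps < d t tstar)%R]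
       @[n --> \oo] --> (0 : \bar R)}.
Proof.
pose Q : probability Y R := distribution P (X 0%N).
have QE B : measurable B -> Q B = \int[mu]_(y in B) (f0 y)%:E by case: X_iid => _;
  exact.
pose Lam : probability (seqspace Y) R := distribution P (sample_path X).
have LamE n B : (forall i, measurable (B i)) -> Lam (cylinder n B) = \prod_(i < n) Q (B i).
  exact: sample_path_cylinder X_iid n B.
pose q := pratio p tstar.
have q0 t y : (0 <= q t y)%R by apply: pratio_ge0; exact: p_family.
have mq : measurable_fun setT (fun z : T * Y => q z.1 z.2).
  by apply: measurable_pratio; exact: p_family.
have star_pos : {ae Q, forall y, (0 < p tstar y)%R}.
  exact: (ae_density f0_density QE (star_pos_ae f0_density p_family tstar_fin)).
pose r : R := expR (- (eps ^+ 2 / 20%:R)).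
have eps2 : (0 < eps ^+ 2)%R by rewrite exprn_gt0.
have r01 : (0 < r < 1)%R.
  by rewrite expR_gt0 /= -expR0 ltr_expR oppr_lt0 divr_gt0.
pose S j := [set t | F0 t /\ (j%:R * eps <= d t tstar < j.+1%:R * eps)%R].
have [N [c hc]] := @bounded_covering_number T R d S (fun j => j%:R * eps / 3%:R)%R tstar N_bounded.
pose ball j i := dball d (c j i) (j.+1%:R * eps / 3%:R)%R.
(* A ball that misses its annulus may come close to [tstar]; it is replaced by the empty set, for
   which closure under mixtures and the moment bound are vacuous. *)
pose A j i := if `[< ball j i `&` S j.+1 !=set0 >] then ball j i else set0.
have mA j i : measurable (A j i) by rewrite /A; case: asboolP => _ //;
  exact: d_balls_measurable.
have cA j i : mix_closed Q q (A j i).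
  rewrite /A; case: asboolP => _.
    apply: (mixture_convex_mix_closed tstar f0_density p_family QE);
      first exact: d_balls_measurable.
    exact: d_balls_convex.
  by move=> nu; rewrite measure0 => /esym/eqP; rewrite onee_eq0.
have A_moment j i t : A j i t ->
    exists2 a, unitI a & rmoment Q q t a < (r ^+ (2 * j.+1))%:E.
  rewrite /A; case: asboolP => // -[s [bs [_ /andP[hs _]]]] bt.
  have j0 : (0 < j.+1%:R * eps)%R by rewrite mulr_gt0.
  have far : (j.+1%:R * eps / 3%:R <= d t tstar)%R.
    have : (d s tstar / 3%:R <= d t tstar)%R.
      by apply: far_ball bs bt => //; rewrite ler_pM2r.
    by apply: le_trans; rewrite ler_pM2r.
  have del0 : (0 < j.+1%:R * eps / 3%:R)%R by rewrite divr_gt0.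
  apply: (small_moment f0_density p_family tstar_fin QE).
    by rewrite exprn_ile1//; case/andP : r01 => /ltW ? /ltW.
  (* The contrapositive of condition (2) at a third of the inner radius; what remains compares
     [j.+1 ^ 2 / 9] with [j.+1 / 10]. *)
  apply: (@le_lt_trans _ _ (expR (- (j.+1%:R * eps / 3%:R) ^+ 2))%:E).
    rewrite leNgt; apply/negP => /(h_d _ del0) /=.
    by rewrite ltNge far.
  rewrite lte_fin /r -expRM_natl ltr_expR -mulr_natl.
  have j1 : (1 <= j.+1%:R :> R)%R by rewrite ler1n.
  have jj : (j.+1%:R * eps ^+ 2 <= j.+1%:R ^+ 2 * eps ^+ 2)%R.
    by rewrite ler_pM2r// expr2 -[X in (X <= _)%R]mul1r ler_pM2r// ltr0n.
  have jp : (0 < j.+1%:R * eps ^+ 2)%R by rewrite mulr_gt0.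
  rewrite natrM; move: jj jp; rewrite exprMn exprMn; lra.
pose U := [set t | (eps < d t tstar)%R].
have mU : measurable U by exact: measurable_ball_exterior.
pose V := \bigcup_j \bigcup_(i in [set i | (i < N)%N]) A j i.
have mV : measurable V.
  by apply: bigcup_measurable => j _; apply: bigcup_measurable => i _; exact: mA.
have nU : Pi.-negligible (U `\` V).
  have mUV : measurable (U `\` V) by exact: measurableD.
  (* [carried_by] speaks of measurable supersets of [F0], and this complement is one: points of [F0]
     in [U] lie in an annulus, hence in some [A j i]. *)
  have : Pi (~` (U `\` V)) = 1.
    apply: Pi_F0; first exact: measurableC.
    move=> t F0t [Ut nV]; apply: nV.
    have [j hj] := annulus eps_gt0 Ut.
    have St : S j.+1 t by [].
    have [i iN bt] := hc j t St; exists j => //; exists i => //.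
    by rewrite /A; case: asboolP => // h; apply: h; exists t.
  rewrite probability_setC// => h.
  suff P0 : Pi (U `\` V) = 0 by apply/negligibleP.
  have : Pi (U `\` V) \is a fin_num by exact: fin_num_measure.
  move: h; case: (Pi (U `\` V)) => [a| |] //= /eqP.
  rewrite -EFinB eqe => /eqP h _; rewrite (_ : a = 0%R)//; move: h; lra.
have num := ae_likelihood_cover LamE q0 mq mA cA r01 A_moment mU nU.
(* Half the rate of the numerator: [r] is [expR (- e)] squared, so one factor [expR (- e) ^+ n]
   survives the division. *)
pose e : R := (eps ^+ 2 / 40%:R)%R.
have e0 : (0 < e)%R by rewrite divr_gt0.
pose B := [set t | KLstar mu f0 (p tstar) (p t) < e%:E].
have mKL : measurable_fun setT (fun t => KL mu f0 (p t) - KL mu f0 (p tstar)).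
  by apply: emeasurable_funB => //; exact: measurable_KL.
have mB : measurable B.
  by rewrite -[X in measurable X]setTI; exact: measurable_lte.
have fd t := family_density p_family t.
have KLfin t : B t -> KL mu f0 (p t) < +oo.
  rewrite /B /= /KLstar => h; rewrite ltNge leye_eq; apply/negP => /eqP foo.
  by move: h; rewrite foo addye//; move: tstar_fin;
    rewrite -fin_numN fin_numE => /andP[].
have den : {ae Lam, forall x : seqspace Y, exists2 kappa : R, (0 < kappa)%R &
     forall n, (kappa * expR (- (e * n%:R)))%:E <= \int[Pi]_t (\prod_(i < n) q t (x i))%:E}.
  apply: (mass_lower_bound LamE q0 mq mB (prior_pos _ e0)) => t Bt.
    apply: (ae_density f0_density QE).
    apply: filterS2 (KL_pos_ae f0_density (fd t) (KLfin t Bt)) (star_pos_ae f0_density p_family tstar_fin).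
    by move=> y h1 h2 f00; rewrite /q /pratio divr_gt0 ?h1 ?h2.
  pose Z y := (- ln (p t y / p tstar y) - e)%R.
  apply: (walk_bounded LamE (Z := Z)).
    apply: measurable_funB => //; apply: measurableT_comp => //.
    apply: (measurableT_comp (@measurable_ln R)).
    by apply: measurable_fun_div; [have [] := fd t|have [] := fd tstar].
  exact: (log_ratio_drift f0_density QE (fd t) (fd tstar) tstar_fin Bt).
have pos := ae_coord LamE star_pos.
apply: filterS3 (ae_sample_path num) (ae_sample_path den) (ae_sample_path pos).
move=> w [n0 hnum] [kappa k0 hden] hpos.
have prodE n t : \prod_(i < n) density_ratio (p t) (p tstar) (X i w) =
    (\prod_(i < n) q t (sample_path X w i))%:E.
  apply: (big_rec2 (fun a b => a = b%:E)) => // i a b _ ->.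
  by rewrite EFinM density_ratioE//; exact: (hpos i).
have postE n : posterior p Pi (p tstar) X n w U =
    likelihood q Pi U n (fun=> 1%R) (sample_path X w) /
    \int[Pi]_t (\prod_(i < n) q t (sample_path X w i))%:E.
  rewrite /posterior /likelihood; congr (_ / _); apply: eq_integral => t _.
    by rewrite mul1r prodE.
  by rewrite prodE.
have L0 n : 0 <= likelihood q Pi U n (fun=> 1%R) (sample_path X w).
  by apply: integral_ge0 => t _; rewrite lee_fin mul1r prodr_ge0.
pose C : R := (N%:R / (1 - r) / kappa)%R.
have bound n : (n0 <= n)%N -> posterior p Pi (p tstar) X n w U <= (C * (expR (- e)) ^+ n)%:E.
  move=> nn0; rewrite postE.
  have kn : (0 < kappa * expR (- (e * n%:R)))%R by rewrite mulr_gt0 ?expR_gt0.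
  apply: (le_trans (lee_div_bounds (L0 n) (hnum n nn0) kn (hden n))).
  rewrite lee_fin le_eqVlt; apply/orP; left; apply/eqP.
  have -> : (r ^+ n = expR (- (e * n%:R)) * expR (- e) ^+ n)%R.
    by rewrite /r -!expRM_natl -expRD; congr expR; rewrite /e; field.
  by rewrite /C; field; rewrite !gt_eqF ?expR_gt0 ?subr_gt0//; case/andP : r01.
have cvgC : (C * (expR (- e)) ^+ n)%:E @[n --> \oo] --> 0.
  apply: cvg_EFin; first exact: nearW.
  rewrite -[X in _ --> X](mulr0 C); apply: cvgM; first exact: cvg_cst.
  apply: cvg_expr; rewrite ger0_norm ?expR_ge0// -expR0 ltr_expR; lra.
apply: (@squeeze_cvge _ _ _ _ (fun=> 0) _ (fun n => (C * (expR (- e)) ^+ n)%:E)) => //.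
- exists n0 => // n /= hn; rewrite bound// andbT postE mule_ge0// inve_ge0.
  by apply: integral_ge0 => t _; rewrite lee_fin prodr_ge0.
- exact: cvg_cst.
Qed.
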